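(* Let $T>0$, $\alpha\in(0,1)$, $p\in(1,\frac1\alpha]$, and let $\pi=(\pi^n)_{n\ge0}$ be a balanced, convergent refining partition sequence of $[0,T]$, with associated constants $M,c,a,b$. All functions $x$ below are assumed to satisfy $x(0)=x(T)=0$. Then the mapping $$T^\pi_{\alpha,(p)}:\Big(C^{0,\alpha}([0,T])\cap\mathcal{X}^p_\pi,\ \Vert\cdot\Vert_{C^{0,\alpha}}+\Vert\cdot\Vert^{(p)}_\pi\Big)\longrightarrow\Big(\mathcal{M}^\alpha_\pi\cap\mathcal{M}^{(p)}_\pi,\ \Vert\cdot\Vert^\alpha_{sup}+\Vert\cdot\Vert_{(p)}\Big),\qquad x\longmapsto\Theta^{x,\pi},$$ is an isomorphism (a linear bijection that is bounded with bounded inverse). Furthermore, the operator norms satisfy $$\Vert T^\pi_{\alpha,(p)}\Vert_{op}\le\max\Bigg(2(\sqrt c)^3,\ \frac{(M+1)^2c^{\frac32}b^{\frac32-\frac1p}}{\big((1+a)^{1-\frac1p}-1\big)^{\frac1p}}\Bigg),$$ $$\Vert(T^\pi_{\alpha,(p)})^{-1}\Vert_{op}\le1+\max\Big(2M\sqrt cK^\alpha_1+2MK^\alpha_2,\ MK^\alpha_2|\pi^1|^\alpha\Big)+\frac{c^{\frac1p}(Mc\sqrt{bM})}{(1+a)^{1-\frac1p}-1},$$ where $K^\alpha_1:=\frac1{1-(1+a)^{\alpha-1}}$ and $K^\alpha_2:=\frac1{1-(1+a)^{-\alpha}}$.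
   Context: $C^0([0,T])$ is the space of real-valued continuous functions on $[0,T]$. A sequence of partitions $\pi=(\pi^n)_{n\ge0}$ of $[0,T]$ is written $\pi^n=(0=t^n_0<t^n_1<\cdots<t^n_{N(\pi^n)}=T)$, with $\pi^0=\{0,T\}$. It is refining if $\pi^0\subseteq\pi^1\subseteq\cdots$. Write $\underline{\pi^n}:=\inf_i|t^n_{i+1}-t^n_i|$ and $|\pi^n|:=\sup_i|t^n_{i+1}-t^n_i|$. $\Pi([0,T])$ is the collection of all refining partition sequences with $|\pi^n|\to0$. Types of partition sequences. $\pi\in\Pi([0,T])$ is finitely refining if there is a positive integer $M$ such that the number of partition points of $\pi^{n+1}$ within any two consecutive partition points of $\pi^n$ is bounded above by $M$ for all $n\ge0$ (i.e. each interval of $\pi^n$ is divided into at most $M$ intervals of $\pi^{n+1}$; in particular $N(\pi^n)\le M^n$). It is balanced if there is $c>1$ with $|\pi^n|/\underline{\pi^n}\le c$ for every $n\in\mathbb{N}$. It is complete refining if it is finitely refining and there are positive constants $a,b$ with $1+a\le|\pi^n|/|\pi^{n+1}|\le b$ for every $n\in\mathbb{N}$. It is convergent refining if it is complete refining and $\lim_{n\to\infty}|\pi^n|/|\pi^{n+1}|=r\in(1,\infty)$ exists. Function norms. $[x]^{(p)}_{\pi^n}(T):=\sum_{j=0}^{N(\pi^n)-1}|x(t^n_{j+1})-x(t^n_j)|^p$; $\Vert x\Vert^{(p)}_\pi:=|x(0)|+\sup_{n\in\mathbb{N}}([x]^{(p)}_{\pi^n}(T))^{1/p}$; $\mathcal{X}^p_\pi:=\{x\in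 C^0([0,T]):\Vert x\Vert^{(p)}_\pi<\infty\}$. $C^{0,\alpha}([0,T])$ is the space of $\alpha$-Hölder continuous functions with norm $\Vert x\Vert_{C^{0,\alpha}}:=\sup_{t\in[0,T]}|x(t)|+\sup_{s\ne t}\frac{|x(s)-x(t)|}{|s-t|^\alpha}$. Schauder coefficients. Let $p(m,k):=\inf\{j\ge0:t^{m+1}_j\ge t^m_k\}$, so $t^m_k=t^{m+1}_{p(m,k)}$. For $m\ge0$, $0\le k\le N(\pi^m)-1$, $2\le i\le p(m,k+1)-p(m,k)$, put $t_1=t^{m+1}_{p(m,k)}$, $t_2=t^{m+1}_{p(m,k)+i-1}$, $t_3=t^{m+1}_{p(m,k)+i}$ and $$\theta^{x,\pi}_{m,k,i}:=\frac{(x(t_2)-x(t_1))(t_3-t_2)-(x(t_3)-x(t_2))(t_2-t_1)}{\sqrt{(t_2-t_1)(t_3-t_2)(t_3-t_1)}} .$$ For each $m$, these coefficients (over all pairs $(k,i)$, in a fixed order) are re-indexed as $\theta^{x,\pi}_{m,k}$, $k\in I_m:=\{0,1,\dots,N(\pi^{m+1})-N(\pi^m)-1\}$. Matrices. $\mathcal{M}$ is the space of infinite real matrices $A=(A_{m,k})_{m\ge0,k\ge0}$, and $\mathcal{M}_\pi:=\{A\in\mathcal{M}:A_{m,k}=0\text{ if }k\ge|I_m|\}$, where $|I_m|$ is the cardinality of $I_m$. The Schauder coefficient matrix $\Theta^{x,\pi}\in\mathcal{M}_\pi$ has entries $(\Theta^{x,\pi})_{m,k}=\theta^{x,\pi}_{m,k}$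 if $k\in I_m$ and $0$ otherwise. Norms: $$\Vert A\Vert^\alpha_{sup}:=\sup_{m,k\ge0}|\pi^{m+1}|^{\frac12-\alpha}|A_{m,k}|,\qquad\Vert A\Vert_{(p)}:=\sup_{m\ge0}|\pi^m|^{\frac12}\Big(\sum_{k\ge0}|A_{m,k}|^p\Big)^{\frac1p},$$ and $\mathcal{M}^\alpha_\pi:=\{A\in\mathcal{M}_\pi:\Vert A\Vert^\alpha_{sup}<\infty\}$, $\mathcal{M}^{(p)}_\pi:=\{A\in\mathcal{M}_\pi:\Vert A\Vert_{(p)}<\infty\}$. *)

(* Defs.v *)
From mathcomp Require Import all_boot all_order all_algebra.
From mathcomp Require Import all_classical all_reals all_analysis.
Set Implicit Arguments.
Unset Strict Implicit.
Unset Printing Implicit Defensive.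
Import Order.TTheory GRing.Theory Num.Theory.
Import numFieldNormedType.Exports.
Local Open Scope classical_set_scope.
Local Open Scope ring_scope.

(* As in [itv_partition], the list [pi n] contains the points of the n-th
   partition of [0, T] other than the left endpoint 0, in increasing order.
   So N(pi^n) is [size (pi n)]. *)
Section partitions.
Context {R : realType}.
Implicit Types (pi : nat -> seq R) (T : R).

Definition ppoints pi n : seq R := 0 :: pi n.

Definition ptime pi n i : R := nth 0 (ppoints pi n) i.

Definition psteps pi n : set R :=
  [set `|ptime pi n i.+1 - ptime pi n i| | i in `I_(size (pi n))].

Definition mesh pi n : R := sup (psteps pi n).
Definition min_mesh pi n : R := inf (psteps pi n).

Definition refining_partitions T pi :=
  [/\ forall n, itv_partition 0 T (pi n),
      pi 0%N = [:: T],
      forall n, {subset ppoints pi n <= ppoints pi n.+1} &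
      mesh pi n @[n --> \oo] --> (0 : R)].

(* p(m,k) = inf {j >= 0 : t^{m+1}_j >= t^m_k} *)
Definition pindex pi m k : nat :=
  find (fun s => ptime pi m k <= s) (ppoints pi m.+1).

(* Number of intervals of pi^{m+1} that make up the k-th interval of pi^m. *)
Definition nsub pi m k : nat := (pindex pi m k.+1 - pindex pi m k)%N.

Definition finitely_refining pi (M : nat) :=
  (0 < M)%N /\
  forall n k, (k < size (pi n))%N -> (nsub pi n k <= M)%N.

Definition balanced pi (c : R) :=
  1 < c /\ forall n, mesh pi n / min_mesh pi n <= c.

Definition complete_refining pi (M : nat) (a b : R) :=
  [/\ finitely_refining pi M, 0 < a, 0 < b &
      forall n, 1 + a <= mesh pi n / mesh pi n.+1 <= b].

Definition convergent_refining pi (M : nat) (a b : R) :=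
  complete_refining pi M a b /\
  exists2 r : R, 1 < r & mesh pi n / mesh pi n.+1 @[n --> \oo] --> r.

End partitions.

Section function_spaces.
Context {R : realType}.
Implicit Types (pi : nat -> seq R) (T alpha p : R) (x : R -> R).

(* A function on [0, T] is represented by its extension by zero to R, so that
   Leibniz equality of representatives is equality of functions on [0, T]. *)
Definition C0 T : set (R -> R) :=
  [set x | {within `[0, T], continuous x} /\
           forall t, t \notin `[0, T] -> x t = 0].

(* ([x]^{(p)}_{pi^n}(T))^{1/p} is [pvar pi p n x `^ p^-1]. *)
Definition pvar pi p n x : R :=
  \sum_(j < size (pi n)) `|x (ptime pi n j.+1) - x (ptime pi n j)| `^ p.

Definition pvar_norm pi p x : \bar R :=
  (`|x 0|%:E + ereal_sup (range (fun n => (pvar pi p n x `^ p^-1)%:E)))%E.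

Definition Xp T pi p : set (R -> R) :=
  [set x | C0 T x /\ (pvar_norm pi p x < +oo)%E].

Definition Holder T alpha : set (R -> R) :=
  [set x | C0 T x /\
    exists C : R, forall s t, s \in `[0, T] -> t \in `[0, T] ->
      `|x s - x t| <= C * `|s - t| `^ alpha].

Definition Holder_norm T alpha x : \bar R :=
  (ereal_sup [set `|x t|%:E | t in [set` `[0%R, T]]] +
   ereal_sup [set (`|x s.1 - x s.2| / `|s.1 - s.2| `^ alpha)%:E
             | s in [set s : R * R | [/\ s.1 \in `[0%R, T], s.2 \in `[0%R, T] &
                                 s.1 != s.2]]])%E.

Definition vanish_at_ends T : set (R -> R) := [set x | x 0 = 0 /\ x T = 0].

End function_spaces.

Section schauder.
Context {R : realType}.
Implicit Types (pi : nat -> seq R) (alpha p : R) (x : R -> R)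
  (A : nat -> nat -> R).

Definition theta pi x m k i : R :=
  let t1 := ptime pi m.+1 (pindex pi m k) in
  let t2 := ptime pi m.+1 (pindex pi m k + i - 1) in
  let t3 := ptime pi m.+1 (pindex pi m k + i) in
  ((x t2 - x t1) * (t3 - t2) - (x t3 - x t2) * (t2 - t1)) /
  Num.sqrt ((t2 - t1) * (t3 - t2) * (t3 - t1)).

(* The pairs (k, i) with 0 <= k < N(pi^m) and 2 <= i <= p(m,k+1) - p(m,k). *)
Definition theta_indices pi m : seq (nat * nat) :=
  [seq (k, i) | k <- iota 0 (size (pi m)), i <- iota 2 (nsub pi m k - 1)].

(* e m is an ordering of all the pairs (k, i) of level m. *)
Definition schauder_order pi (e : nat -> seq (nat * nat)) :=
  forall m, perm_eq (e m) (theta_indices pi m).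

(* |I_m| *)
Definition cardI pi m : nat := (size (pi m.+1) - size (pi m))%N.

Definition Theta pi (e : nat -> seq (nat * nat)) x : nat -> nat -> R :=
  fun m k => if (k < cardI pi m)%N
             then let ki := nth (0, 0)%N (e m) k in theta pi x m ki.1 ki.2
             else 0.

Definition Mpi pi : set (nat -> nat -> R) :=
  [set A | forall m k, (cardI pi m <= k)%N -> A m k = 0].

Definition mx_sup_norm pi alpha A : \bar R :=
  ereal_sup (range (fun mk : nat * nat =>
    (mesh pi mk.1.+1 `^ (1 / 2 - alpha) * `|A mk.1 mk.2|)%:E)).

Definition mx_p_norm pi p A : \bar R :=
  ereal_sup (range (fun m : nat =>
    ((mesh pi m `^ (1 / 2))%:E *
     (\sum_(0 <= k <oo) (`|A m k| `^ p)%:E) `^ p^-1)%E)).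

Definition Malpha pi alpha : set (nat -> nat -> R) :=
  [set A | Mpi pi A /\ (mx_sup_norm pi alpha A < +oo)%E].

Definition Mp pi p : set (nat -> nat -> R) :=
  [set A | Mpi pi A /\ (mx_p_norm pi p A < +oo)%E].

End schauder.

(* Normed spaces are given by a linear subspace D (resp. E) of an ambient
   module together with a norm ND (resp. NE), finite on the subspace. *)
Section operators.
Context {R : realType} {U V : lmodType R}.
Implicit Types (D : set U) (E : set V).

Definition op_norm (W W' : Type) (D : set W) (ND : W -> \bar R)
    (NE : W' -> \bar R) (f : W -> W') : \bar R :=
  ereal_sup [set NE (f x) | x in D `&` [set x | (ND x <= 1)%E]].

Definition linear_on D (f : U -> V) :=
  forall (k : R) x y, D x -> D y -> f (k *: x + y) = k *: f x + f y.

Definition inverse_on D (f : U -> V) : V -> U := 'pinv_(fun=> 0) D f.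

Definition isomorphism D (ND : U -> \bar R) E (NE : V -> \bar R)
    (f : U -> V) :=
  [/\ linear_on D f, set_bij D E f,
      (op_norm D ND NE f < +oo)%E &
      (op_norm E NE ND (inverse_on D f) < +oo)%E].

End operators.

(* Main.v *)
Require Import Defs.
From mathcomp Require Import all_boot all_order all_algebra.
From mathcomp Require Import all_classical all_reals all_analysis.
From mathcomp Require Import ring lra zify.
Set Implicit Arguments.
Unset Strict Implicit.
Unset Printing Implicit Defensive.
Import Order.TTheory GRing.Theory Num.Theory.
Import numFieldNormedType.Exports.
Local Open Scope classical_set_scope.
Local Open Scope ring_scope.

(** The coefficients of x at level m are the coordinates, in the basis of
    triangular Schauder functions, of the difference between the piecewise
    linear interpolants of x on pi^(m+1) and on pi^m.  So the inverse of
    x |-> Theta x sends a matrix A to the sum over m of its level functions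
    f_m, where f_m is piecewise affine on pi^(m+1), vanishes on pi^m, and is
    the combination of the Schauder functions of level m with weights A m.
    Write d_m for the mesh of pi^(m+1).

    Injectivity.  If x has zero coefficients, it is affine along the nodes of
    every subdivided interval; since it vanishes at 0 and T, it vanishes at all
    partition points, which are dense ([theta_eq0]).

    Boundedness of Theta.  A coefficient is a difference of two slopes,
    normalised by the step lengths.  For a Hoelder function it is bounded by
    powers of these lengths, all comparable to d_m
    ([schauder_coef_Holder]).  In terms of the p-th variation, it is at most
    the sum of the absolute increments of x over its interval of pi^m divided
    by the square root of d_m / c, a lower bound of the steps, and the power
    mean inequality over the at most M increments gives the bound on the
    p-norm ([sum_Theta_powR_le]).

    Boundedness of the inverse, Hoelder part.  If the sup-norm of A is at most
    s, then f_m is bounded by (M / 2) s d_m^alpha and is Lipschitz with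
    constant M sqrt(c) s d_m^(alpha - 1) ([schauder_level_sup] and
    [schauder_level_lip]).  The d_m decrease geometrically, so the sup-norm of
    the sum is governed by the first mesh; in an increment between t and t' the
    Lipschitz bound is used for the levels with d_m >= |t - t'| and the sup
    bound for the others, which produces K1 and K2
    ([schauder_partial_Holder]).  The factor 1 / 2 in the sup bound matters:
    with it the sup-norm and the Hoelder seminorm are each at most half of one
    of the two quantities in the maximum of the theorem, so that their sum is
    at most this maximum.

    Boundedness of the inverse, variation part.  For g affine on the intervals
    of a partition, the energy, sum of |dg|^p |dt|^(1 - p), does not change
    when the partition is refined.  Hence the p-th variation of f_m along pi^n
    decays like (|pi^n| / d_m)^(p - 1) for n > m ([pvar_affine_le]), and
    Minkowski's inequality sums the levels m < n, the only ones that are seen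
    by pi^n ([pvar_schauder_partial]). *)

(** * Inequalities for sums of powers *)
Section PowerSums.
Context {R : realType}.
Implicit Types (p a h : R).

Lemma convex_powR_comb p (s t x y : R) : 1 <= p -> 0 <= s -> 0 <= t ->
  s + t = 1 -> 0 <= x -> 0 <= y ->
  (s * x + t * y) `^ p <= s * x `^ p + t * y `^ p.
Proof.
move=> p1 s0 t0 st1 x0 y0.
have s01 : 0 <= s <= 1 by rewrite s0 -st1 lerDl.
have -> : t = 1 - s by rewrite -st1 addrAC subrr add0r.
have := convex_powR p1 (Itv01 (proj1 (andP s01)) (proj2 (andP s01))).
move=> /(_ x y).
rewrite !inE /= !in_itv /= !andbT => /(_ x0 y0).
by rewrite !convRE.
Qed.

(** The power mean inequality, by induction on the number of terms: the new
    mean is a convex combination of the old mean and the new term. *)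
Lemma powR_sum_le (I : Type) (r : seq I) (n : nat) p (f : I -> R) :
  1 <= p -> (forall i, 0 <= f i) -> (size r <= n)%N ->
  (\sum_(i <- r) f i) `^ p <= n%:R `^ (p - 1) * \sum_(i <- r) f i `^ p.
Proof.
move=> p1 f0 rn.
have p0 : 0 < p by lra.
have sum0 : 0 <= \sum_(i <- r) f i `^ p.
  by apply: sumr_ge0 => i _; exact: powR_ge0.
suff : (\sum_(i <- r) f i) `^ p <=
    (size r)%:R `^ (p - 1) * \sum_(i <- r) f i `^ p.
  move=> /le_trans; apply; apply: ler_wpM2r => //.
  by apply: ge0_ler_powR; rewrite ?nnegrE ?ler_nat ?subr_ge0.
elim: r {rn sum0} => [|i r IH]; first by rewrite !big_nil powR0 ?mulr0 ?gt_eqF.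
rewrite !big_cons /=.
set S := \sum_(j <- r) f j; set Q := \sum_(j <- r) f j `^ p.
have S0 : 0 <= S by apply: sumr_ge0.
have [r0|r0] := posnP (size r).
  have -> : S = 0 by rewrite /S (size0nil r0) big_nil.
  have -> : Q = 0 by rewrite /Q (size0nil r0) big_nil.
  by rewrite r0 !addr0 powR1 mul1r.
set m := size r in IH r0 *; set x : R := m.+1%:R.
have x0 : 0 < x by rewrite ltr0n.
have m0 : 0 < m%:R :> R by rewrite ltr0n.
have -> : f i + S = x * (x^-1 * f i + (m%:R / x) * (S / m%:R)).
  by field; rewrite !gt_eqF.
have x_ge0 := ltW x0; have m_ge0 := ltW m0.
rewrite powRM ?addr_ge0 ?mulr_ge0 ?invr_ge0//.
apply: (@le_trans _ _ (x `^ p * (x^-1 * f i `^ p + (m%:R / x) * (S / m%:R) `^ p))).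
  apply: ler_wpM2l; first exact: powR_ge0.
  apply: convex_powR_comb => //; rewrite ?divr_ge0 ?invr_ge0//.
  by rewrite /x -natr1; field; rewrite natr1 gt_eqF.
have -> : x `^ p = x `^ (p - 1) * x.
  by rewrite -{3}(powRr1 x_ge0) -powRD ?subrK// (gt_eqF x0) implybT.
rewrite -mulrA; apply: ler_wpM2l; first exact: powR_ge0.
have -> : x * (x^-1 * f i `^ p + m%:R / x * (S / m%:R) `^ p) =
   f i `^ p + m%:R * (S / m%:R) `^ p by field; rewrite gt_eqF.
rewrite lerD2l powRM ?invr_ge0//.
rewrite mulrCA.
have -> : m%:R^-1 `^ p = m%:R^-1 / m%:R `^ (p - 1).
  rewrite -[in m%:R^-1 `^ p](powR_inv1 (ltW m0)) -powRrM.
  rewrite -[in RHS](powR_inv1 (ltW m0)) -powRN -powRD ?(gt_eqF m0) ?implybT//.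
  by congr powR; ring.
rewrite [leLHS](_ : _ = S `^ p / m%:R `^ (p - 1)).
  by rewrite ler_pdivrMr ?powR_gt0// mulrC.
by field; rewrite !gt_eqF ?powR_gt0.
Qed.

(** Minkowski's inequality: f + g is A + B times the convex combination, with
    weights A / (A + B) and B / (A + B), of f / A and g / B, and the p-th
    power is convex. *)
Lemma minkowski2 (I : Type) (r : seq I) p (f g : I -> R) (A B : R) :
  1 <= p -> 0 < A -> 0 < B ->
  \sum_(i <- r) `|f i| `^ p <= A `^ p -> \sum_(i <- r) `|g i| `^ p <= B `^ p ->
  \sum_(i <- r) `|f i + g i| `^ p <= (A + B) `^ p.
Proof.
move=> p1 A0 B0 fA gB.
have AB0 : 0 < A + B by rewrite addr_gt0.
have H i : `|f i + g i| `^ p <= (A + B) `^ p *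
   (A / (A + B) * (`|f i| `^ p / A `^ p) + B / (A + B) * (`|g i| `^ p / B `^ p)).
  have E (C y : R) : 0 < C -> 0 <= y -> y `^ p / C `^ p = (y / C) `^ p.
    move=> C0 y0; have C_ge0 := ltW C0; rewrite powRM ?invr_ge0//; congr (_ * _).
    by rewrite -[in RHS](powR_inv1 (ltW C0)) -powRrM mulN1r powRN.
  rewrite !E//.
  apply: (@le_trans _ _ ((`|f i| + `|g i|) `^ p)).
    apply: ge0_ler_powR; rewrite ?nnegrE ?addr_ge0 ?ler_normD//; lra.
  have -> : `|f i| + `|g i| = (A + B) *
      (A / (A + B) * (`|f i| / A) + B / (A + B) * (`|g i| / B)).
    by field; rewrite !gt_eqF.
  have AD : 0 <= A / (A + B) by rewrite divr_ge0 ?ltW.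
  have BD : 0 <= B / (A + B) by rewrite divr_ge0 ?ltW.
  have A_ge0 := ltW A0; have B_ge0 := ltW B0.
  rewrite powRM ?addr_ge0 ?mulr_ge0 ?invr_ge0 ?addr_ge0//.
  apply: ler_wpM2l; first exact: powR_ge0.
  apply: convex_powR_comb => //; rewrite ?divr_ge0//.
  by field; rewrite gt_eqF.
apply: (le_trans (ler_sum _ (fun i _ => H i))).
rewrite -mulr_sumr -[X in _ <= X]mulr1; apply: ler_wpM2l; first exact: powR_ge0.
rewrite big_split/= -!mulr_sumr -!mulr_suml.
have -> : 1 = A / (A + B) * 1 + B / (A + B) * 1 by field; rewrite gt_eqF.
have A_ge0 := ltW A0; have B_ge0 := ltW B0; have AB_ge0 := ltW AB0.
apply: lerD; apply: ler_wpM2l; rewrite ?divr_ge0//.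
  by rewrite ler_pdivrMr ?powR_gt0// mul1r.
by rewrite ler_pdivrMr ?powR_gt0// mul1r.
Qed.

Lemma minkowski_sum (I : Type) (r : seq I) p (n : nat) (f : nat -> I -> R)
    (C : nat -> R) :
  1 <= p -> (forall m, 0 < C m) ->
  (forall m, (m < n)%N -> \sum_(i <- r) `|f m i| `^ p <= C m `^ p) ->
  \sum_(i <- r) `|\sum_(m < n) f m i| `^ p <= (\sum_(m < n) C m) `^ p.
Proof.
move=> p1 C0; elim: n => [|n IH] H.
  rewrite big1 ?powR_ge0// => i _.
  by rewrite big_ord0 normr0 powR0// gt_eqF//; lra.
have [->|n0] := posnP n.
  rewrite big_ord1; under eq_bigr do rewrite big_ord1.
  exact: H.
under eq_bigr do rewrite big_ord_recr/=.
rewrite big_ord_recr/=; apply: minkowski2 => //; last exact: H.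
- case: n n0 {H IH} => // n _.
  by rewrite big_ord_recl ltr_pwDl// sumr_ge0// => i _; exact: ltW.
- by apply: IH => m mn; apply: H; exact: ltnW.
Qed.

End PowerSums.

(** * Power sums over a geometrically decreasing sequence *)
Section GeometricDecay.
Context {R : realType} (a : R) (d : nat -> R).
Hypothesis a0 : 0 < a.
Hypothesis d0 : forall m, 0 < d m.
Hypothesis dS : forall m, (1 + a) * d m.+1 <= d m.

Lemma geometric_const_gt0 (r : R) : r < 0 -> 0 < 1 - (1 + a) `^ r.
Proof.
move=> r0; rewrite subr_gt0 -[r]opprK powRN invf_lt1 ?powR_gt0 ?addr_gt0//.
have : 1 `^ (- r) < (1 + a) `^ (- r).
  by apply: gt0_ltr_powR; rewrite ?nnegrE ?oppr_gt0 ?addr_ge0 ?ltrDl ?ltW.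
by rewrite powR1.
Qed.

(** For a negative exponent the terms increase with the index at a geometric
    rate, so the last one dominates the sum. *)
Lemma sum_powR_last (r : R) n : r < 0 ->
  \sum_(m < n.+1) d m `^ r <= (1 - (1 + a) `^ r)^-1 * d n `^ r.
Proof.
move=> r0; have K0 := geometric_const_gt0 r0.
have u0 : 0 < (1 + a) `^ r by rewrite powR_gt0// addr_gt0.
set K := (1 - _)^-1.
have K1 : K * (1 + a) `^ r + 1 = K.
  by rewrite /K; field; rewrite gt_eqF.
have K1' : 1 <= K.
  by rewrite -K1 lerDr mulr_ge0 ?invr_ge0 ?ltW.
elim: n => [|n IH].
  by rewrite big_ord1 ler_peMl ?powR_ge0.
rewrite big_ord_recr/= -K1 mulrDl mul1r lerD2r.
apply: (le_trans IH); rewrite -mulrA; apply: ler_wpM2l.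
  by rewrite invr_ge0 ltW.
rewrite -powRM; [| |exact: ltW]; last by rewrite addr_ge0 ?ltW.
rewrite -[r]opprK ![_ `^ (- - r)]powRN lef_pV2 ?posrE ?powR_gt0 ?mulr_gt0 ?addr_gt0//.
apply: ge0_ler_powR => //; last exact: ltW.
  by rewrite oppr_ge0 ltW.
by rewrite nnegrE mulr_ge0 ?addr_ge0 ?ltW.
Qed.

Lemma sum_powR_above (r h : R) n : r < 0 -> 0 < h ->
  \sum_(m < n | h <= d m) d m `^ r <= (1 - (1 + a) `^ r)^-1 * h `^ r.
Proof.
move=> r0 h0; have K0 := geometric_const_gt0 r0.
elim: n => [|n IH].
  by rewrite big_ord0 mulr_ge0 ?powR_ge0 ?invr_ge0 ?ltW.
rewrite big_mkcond big_ord_recr/= -big_mkcond/=; case: ifPn => [hn|_]; last first.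
  by rewrite addr0.
apply: (@le_trans _ _ (\sum_(m < n.+1) d m `^ r)).
  rewrite big_ord_recr/= lerD2r [leRHS](bigID (fun m : 'I_n => h <= d m))/= lerDl.
  by apply: sumr_ge0 => i _; exact: powR_ge0.
apply: (le_trans (sum_powR_last n r0)); apply: ler_wpM2l.
  by rewrite invr_ge0 ltW.
rewrite -[r]opprK ![_ `^ (- - r)]powRN lef_pV2 ?posrE ?powR_gt0//.
by apply: ge0_ler_powR; rewrite ?nnegrE// ?oppr_ge0 ltW.
Qed.

End GeometricDecay.

Section GeometricDecayFirst.
Context {R : realType} (a : R).
Hypothesis a0 : 0 < a.
Implicit Types d : nat -> R.

(** For a positive exponent the terms decrease at a geometric rate, so the
    first one dominates the sum. *)
Lemma sum_powR_first (r : R) d n : 0 < r -> (forall m, 0 < d m) ->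
  (forall m, (1 + a) * d m.+1 <= d m) ->
  \sum_(m < n) d m `^ r <= (1 - (1 + a) `^ (- r))^-1 * d 0%N `^ r.
Proof.
move=> r0; have nr0 : - r < 0 by lra.
have K0 := geometric_const_gt0 a0 nr0.
have u0 : 0 < (1 + a) `^ (- r) by rewrite powR_gt0// addr_gt0.
set K := (1 - _)^-1.
have KV : 0 <= K by rewrite invr_ge0 ltW.
have K1 : 1 + K * (1 + a) `^ (- r) = K.
  by rewrite /K; field; rewrite gt_eqF.
elim: n d => [|n IH] d d0 dS.
  by rewrite big_ord0 mulr_ge0 ?powR_ge0.
rewrite big_ord_recl/= -K1 mulrDl mul1r lerD2l.
under eq_bigr do rewrite /bump/= add1n.
apply: (le_trans (IH (fun m => d m.+1) _ _)) => //.
rewrite -mulrA; apply: ler_wpM2l => //.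
rewrite powRN mulrC ler_pdivlMr ?powR_gt0 ?addr_gt0//.
rewrite -powRM ?addr_ge0 ?(ltW a0) ?(ltW (d0 _))//.
by apply: ge0_ler_powR;
  rewrite ?nnegrE ?mulr_ge0 ?addr_ge0 ?(ltW a0) ?(ltW (d0 _)) ?(ltW r0)// mulrC.
Qed.

Lemma sum_powR_below (r h : R) d n : 0 < r -> 0 < h -> (forall m, 0 < d m) ->
  (forall m, (1 + a) * d m.+1 <= d m) ->
  \sum_(m < n | d m < h) d m `^ r <= (1 - (1 + a) `^ (- r))^-1 * h `^ r.
Proof.
move=> r0 h0; have nr0 : - r < 0 by lra.
have K0 := geometric_const_gt0 a0 nr0.
elim: n d => [|n IH] d d0 dS.
  by rewrite big_ord0 mulr_ge0 ?powR_ge0 ?invr_ge0 ?ltW.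
have [d0h|d0h] := ltP (d 0%N) h.
  apply: (@le_trans _ _ (\sum_(m < n.+1) d m `^ r)).
    rewrite [leRHS](bigID (fun m : 'I_n.+1 => d m < h))/= lerDl.
    by apply: sumr_ge0 => i _; exact: powR_ge0.
  apply: (le_trans (sum_powR_first n.+1 r0 d0 dS)); apply: ler_wpM2l.
    by rewrite invr_ge0 ltW.
  by apply: ge0_ler_powR; rewrite ?nnegrE ?ltW.
rewrite big_mkcond big_ord_recl/= ltNge d0h/= add0r.
under eq_bigr do rewrite /bump/= add1n.
rewrite -big_mkcond/=.
by apply: (IH (fun m => d m.+1)) => // m; exact: dS.
Qed.

End GeometricDecayFirst.

(** * Schauder functions and coefficients of a single triple of nodes *)
Section Affine.
Context {R : realType}.
Implicit Types (g : R -> R) (s t : R).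

(** Affinity as the existence of two coefficients, so that sums, multiples and
    restrictions are immediate. *)
Definition affine_between g s t :=
  exists k l : R, forall r, s <= r <= t -> g r = k + l * r.

Lemma affine_between_sub g s t s' t' : s <= s' -> t' <= t ->
  affine_between g s t -> affine_between g s' t'.
Proof.
move=> ss tt [k [l H]]; exists k, l => r /andP[sr rt].
by apply: H; rewrite (le_trans ss sr) (le_trans rt tt).
Qed.

Lemma affine_between_sum (I : Type) (r : seq I) (P : pred I) (F : I -> R -> R) s t :
  (forall i, P i -> affine_between (F i) s t) ->
  affine_between (fun y => \sum_(i <- r | P i) F i y) s t.
Proof.
move=> H; elim: r => [|i r [k [l IH]]].
  by exists 0, 0 => y _; rewrite big_nil mul0r addr0.
have [Pi|nPi] := boolP (P i); last first.
  by exists k, l => y yst; rewrite big_cons (negbTE nPi) IH.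
have [k' [l' H']] := H i Pi.
by exists (k' + k), (l' + l) => y yst; rewrite big_cons Pi IH// H'//; ring.
Qed.

Lemma affine_betweenZ (b : R) g s t :
  affine_between g s t -> affine_between (fun y => b * g y) s t.
Proof.
by move=> [k [l H]]; exists (b * k), (b * l) => y yst; rewrite H//; ring.
Qed.

Lemma affine_between_le g s t C r : affine_between g s t -> s <= r <= t ->
  `|g s| <= C -> `|g t| <= C -> `|g r| <= C.
Proof.
move=> [k [l H]] /andP[sr rt].
have st := le_trans sr rt.
rewrite (H s) ?lexx// (H t) ?lexx ?st// (H r) ?sr//.
rewrite !ler_norml => /andP[s1 s2] /andP[t1 t2].
have [l0|l0] := leP 0 l; apply/andP; split.
- have := ler_wpM2l l0 sr; lra.
- have := ler_wpM2l l0 rt; lra.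
- have := ler_wnM2l (ltW l0) rt; lra.
- have := ler_wnM2l (ltW l0) sr; lra.
Qed.

Lemma step_index (w : nat -> R) n t : (0 < n)%N -> w 0%N <= t <= w n ->
  exists2 j, (j < n)%N & w j <= t <= w j.+1.
Proof.
case: n => // n _; elim: n => [|n IH] /andP[t0 tn]; first by exists 0%N; rewrite ?t0.
have [wt|tw] := leP (w n.+1) t; first by exists n.+1; rewrite ?wt.
have [|j jn wj] := IH; first by rewrite t0 ltW.
by exists j => //; exact: ltnW.
Qed.

End Affine.

Section SchauderCoef.
Context {R : realType}.
Implicit Types (x : R -> R) (s t : R).

Definition schauder_coef x (t1 t2 t3 : R) : R :=
  ((x t2 - x t1) * (t3 - t2) - (x t3 - x t2) * (t2 - t1)) /
  Num.sqrt ((t2 - t1) * (t3 - t2) * (t3 - t1)).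

(** The triangle supported by the interval from t1 to t3 with its peak at t2.
    Its height makes its own Schauder coefficient equal to 1; it is the
    primitive of the Haar function normalised in L^2. *)
Definition schauder_fun (t1 t2 t3 t : R) : R :=
  Num.sqrt ((t2 - t1) * (t3 - t2) / (t3 - t1)) *
  Num.max 0 (Num.min ((t - t1) / (t2 - t1)) ((t3 - t) / (t3 - t2))).

Lemma schauder_coef_sum (I : Type) (r : seq I) (P : pred I) (b : I -> R)
    (F : I -> R -> R) t1 t2 t3 :
  schauder_coef (fun y => \sum_(i <- r | P i) b i * F i y) t1 t2 t3 =
  \sum_(i <- r | P i) b i * schauder_coef (F i) t1 t2 t3.
Proof.
rewrite /schauder_coef -!sumrB !mulr_suml -sumrB mulr_suml.
by apply: eq_bigr => i _; ring.
Qed.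

Lemma schauder_coef_affine x t1 t2 t3 : t1 <= t2 -> t2 <= t3 ->
  affine_between x t1 t3 -> schauder_coef x t1 t2 t3 = 0.
Proof.
move=> t12 t23 [k [l H]]; rewrite /schauder_coef !H ?lexx ?t12 ?t23 ?(le_trans t12)//.
by rewrite [X in X / _](_ : _ = 0) ?mul0r//; ring.
Qed.

Lemma schauder_coef_eq x y t1 t2 t3 : x t1 = y t1 -> x t2 = y t2 -> x t3 = y t3 ->
  schauder_coef x t1 t2 t3 = schauder_coef y t1 t2 t3.
Proof. by rewrite /schauder_coef => -> -> ->. Qed.

Variables (t1 t2 t3 : R).
Hypotheses (t12 : t1 < t2) (t23 : t2 < t3).
Let h := Num.sqrt ((t2 - t1) * (t3 - t2) / (t3 - t1)).
Let hat := schauder_fun t1 t2 t3.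
Let u0 : 0 < t2 - t1. Proof. by rewrite subr_gt0. Qed.
Let v0 : 0 < t3 - t2. Proof. by rewrite subr_gt0. Qed.
Let w0 : 0 < t3 - t1. Proof. by rewrite subr_gt0 (lt_trans t12). Qed.

Lemma schauder_fun_out t : t <= t1 \/ t3 <= t -> hat t = 0.
Proof.
move=> H; rewrite /hat /schauder_fun max_l ?mulr0// ge_min.
case: H => H; apply/orP; [left|right].
  by rewrite pmulr_lle0 ?invr_gt0// subr_le0.
by rewrite pmulr_lle0 ?invr_gt0// subr_le0.
Qed.

(** The slope is the square root of a difference of consecutive inverse
    lengths, a form in which the slopes of successive triangles from the same
    left end have telescoping squares. *)
Lemma schauder_fun_rise t : t1 <= t <= t2 ->
  hat t = (t - t1) * Num.sqrt ((t2 - t1)^-1 - (t3 - t1)^-1).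
Proof.
move=> /andP[t1t tt2]; rewrite /hat /schauder_fun -/h.
have A : (t - t1) / (t2 - t1) <= 1 by rewrite ler_pdivrMr// mul1r lerD2r.
have B : 1 <= (t3 - t) / (t3 - t2) by rewrite ler_pdivlMr// mul1r; lra.
have C : 0 <= (t - t1) / (t2 - t1) by rewrite divr_ge0 ?subr_ge0// ltW.
rewrite min_l ?(le_trans A)// max_r//.
have -> : h = (t2 - t1) * Num.sqrt ((t2 - t1)^-1 - (t3 - t1)^-1).
  rewrite -[X in X * _](ger0_norm (ltW u0)) -sqrtr_sqr -sqrtrM ?sqr_ge0//.
  by congr Num.sqrt; field; rewrite !gt_eqF.
by field; rewrite gt_eqF.
Qed.

Lemma schauder_fun_fall t : t2 <= t <= t3 ->
  hat t = (t3 - t) * Num.sqrt ((t3 - t2)^-1 - (t3 - t1)^-1).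
Proof.
move=> /andP[t2t tt3]; rewrite /hat /schauder_fun -/h.
have A : (t3 - t) / (t3 - t2) <= 1 by rewrite ler_pdivrMr// mul1r; lra.
have B : 1 <= (t - t1) / (t2 - t1) by rewrite ler_pdivlMr// mul1r; lra.
have C : 0 <= (t3 - t) / (t3 - t2) by rewrite divr_ge0 ?subr_ge0// ltW.
rewrite min_r ?(le_trans A)// max_r//.
have -> : h = (t3 - t2) * Num.sqrt ((t3 - t2)^-1 - (t3 - t1)^-1).
  rewrite -[X in X * _](ger0_norm (ltW v0)) -sqrtr_sqr -sqrtrM ?sqr_ge0//.
  by congr Num.sqrt; field; rewrite !gt_eqF.
by field; rewrite gt_eqF.
Qed.

Lemma schauder_fun_affine s t :
  [\/ t <= t1, (t1 <= s) && (t <= t2), (t2 <= s) && (t <= t3) | t3 <= s] ->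
  affine_between hat s t.
Proof.
case=> [tt|/andP[s1 s2]|/andP[s1 s2]|ss].
- exists 0, 0 => r /andP[sr rt]; rewrite schauder_fun_out; [ring|left].
  exact: le_trans tt.
- exists (- t1 * Num.sqrt ((t2 - t1)^-1 - (t3 - t1)^-1)),
    (Num.sqrt ((t2 - t1)^-1 - (t3 - t1)^-1)) => r /andP[sr rt].
  rewrite schauder_fun_rise; first ring.
  by rewrite (le_trans s1 sr) (le_trans rt s2).
- exists (t3 * Num.sqrt ((t3 - t2)^-1 - (t3 - t1)^-1)),
    (- Num.sqrt ((t3 - t2)^-1 - (t3 - t1)^-1)) => r /andP[sr rt].
  rewrite schauder_fun_fall; first ring.
  by rewrite (le_trans s1 sr) (le_trans rt s2).
- exists 0, 0 => r /andP[sr rt]; rewrite schauder_fun_out; [ring|right].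
  exact: le_trans sr.
Qed.

Lemma schauder_coef_fun : schauder_coef hat t1 t2 t3 = 1.
Proof.
rewrite /schauder_coef (@schauder_fun_out t1); last by left.
rewrite (@schauder_fun_out t3); last by right.
have -> : hat t2 = h.
  rewrite /hat /schauder_fun -/h !divff ?gt_eqF// minxx max_r ?mulr1//.
have -> : Num.sqrt ((t2 - t1) * (t3 - t2) * (t3 - t1)) = (t3 - t1) * h.
  rewrite -[X in _ = X * _](ger0_norm (ltW w0)) -sqrtr_sqr -sqrtrM ?sqr_ge0//.
  by congr Num.sqrt; field; rewrite gt_eqF.
have h0 : 0 < h by rewrite sqrtr_gt0 divr_gt0// mulr_gt0.
by field; rewrite !gt_eqF.
Qed.

Lemma schauder_fun_bounds t : 0 <= hat t <= Num.sqrt (t3 - t2).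
Proof.
rewrite /hat /schauder_fun -/h; set y := Num.max 0 _.
have h0 : 0 <= h by exact: sqrtr_ge0.
have y0 : 0 <= y by rewrite le_max lexx.
have y1 : y <= 1.
  rewrite ge_max ler01/= ge_min; have [tt|tt] := leP t t2; apply/orP; [left|right].
    by rewrite ler_pdivrMr// mul1r lerD2r.
  by rewrite ler_pdivrMr// mul1r; have := ltW tt; lra.
have hv : h <= Num.sqrt (t3 - t2).
  rewrite ler_wsqrtr// ler_pdivrMr// mulrC ler_wpM2l ?ltW//.
  by rewrite ltr_leD.
by rewrite mulr_ge0//= (le_trans _ hv)// ler_piMr.
Qed.

(** Minimum and maximum do not increase distances, so it is enough to bound
    the two slopes; both are at most the inverse square root of the length of
    their side. *)
Lemma schauder_fun_lip (L : R) s t : 0 <= L ->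
  (t2 - t1)^-1 <= L ^+ 2 -> (t3 - t2)^-1 <= L ^+ 2 ->
  `|hat s - hat t| <= L * `|s - t|.
Proof.
move=> L0 Lu Lv.
have clip (a b a' b' e : R) : `|a - a'| <= e -> `|b - b'| <= e ->
    `|Num.max 0 (Num.min a b) - Num.max 0 (Num.min a' b')| <= e.
  rewrite !ler_norml => /andP[? ?] /andP[? ?].
  by case: (leP a b) => ?; case: (leP a' b') => ?; case: (leP 0 _) => ?;
    case: (leP 0 _) => ?; lra.
have h0 : 0 < h by rewrite sqrtr_gt0 divr_gt0// mulr_gt0.
rewrite /hat /schauder_fun -/h -mulrBr normrM (gtr0_norm h0) mulrC -ler_pdivlMr//.
have st : 0 <= `|s - t| by [].
have K (y : R) : 0 < y -> y^-1 <= L ^+ 2 ->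
    (t2 - t1) * (t3 - t2) / (t3 - t1) <= y -> y^-1 * `|s - t| <= L * `|s - t| / h.
  move=> y0 yL hy; rewrite ler_pdivlMr// mulrAC; apply: ler_wpM2r => //.
  have hsq : h ^+ 2 <= y by rewrite sqr_sqrtr// ltW// divr_gt0// mulr_gt0.
  rewrite -(@ler_pXn2r _ 2) ?nnegrE ?mulr_ge0 ?invr_ge0 ?(ltW y0) ?(ltW h0)//.
  rewrite exprMn expr2 -mulrA (le_trans _ yL)// ler_piMr ?invr_ge0 ?(ltW y0)//.
  by rewrite mulrC ler_pdivrMr// mul1r.
apply: clip.
  rewrite (_ : _ - _ = (t2 - t1)^-1 * (s - t)); last by field; rewrite gt_eqF.
  rewrite normrM gtr0_norm ?invr_gt0//; apply: K => //.
  by rewrite ler_pdivrMr// ler_wpM2l ?(ltW u0)//; have := t12; lra.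
rewrite (_ : _ - _ = (t3 - t2)^-1 * (t - s)); last by field; rewrite gt_eqF.
rewrite normrM distrC gtr0_norm ?invr_gt0//; apply: K => //.
by rewrite ler_pdivrMr// mulrC ler_wpM2l ?(ltW v0)//; have := t23; lra.
Qed.

End SchauderCoef.

(** * Schauder functions of one interval and its subdivision *)
Section Block.
Context {R : realType}.
Implicit Types (s t : R).

(** The part of a level function carried by one interval, subdivided by the
    nodes w 0, ..., w n. The triangles share the left end w 0, and the i-th
    one peaks at the node before w i. *)
Definition schauder_block (w : nat -> R) (n : nat) (b : nat -> R) (t : R) : R :=
  \sum_(2 <= i < n.+1) b i * schauder_fun (w 0%N) (w i.-1) (w i) t.

Variables (w : nat -> R) (n : nat) (b : nat -> R).
Hypothesis w_lt : forall i j, (i < j)%N -> (j <= n)%N -> w i < w j.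
Let g := schauder_block w n b.

Let w_le i j : (i <= j)%N -> (j <= n)%N -> w i <= w j.
Proof.
rewrite leq_eqVlt => /predU1P[->//|ij jn]; exact: ltW (w_lt ij jn).
Qed.

Let node1 i : (2 <= i < n.+1)%N -> w 0%N < w i.-1.
Proof. by case/andP => i2 iN; apply: w_lt; lia. Qed.

Let node2 i : (2 <= i < n.+1)%N -> w i.-1 < w i.
Proof. by case/andP => i2 iN; apply: w_lt; lia. Qed.

Lemma schauder_block_out t : t <= w 0%N \/ w n <= t -> g t = 0.
Proof.
move=> H; rewrite /g /schauder_block big_nat_cond big1// => i /andP[iN _].
rewrite schauder_fun_out ?mulr0 ?node1 ?node2//.
case: H => H; [by left|right]; apply: le_trans H; apply: w_le => //.
by move: iN; lia.
Qed.

Lemma schauder_block_affine j : (j < n)%N -> affine_between g (w j) (w j.+1).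
Proof.
move=> jn.
have : affine_between (fun t => \sum_(2 <= i < n.+1 | (2 <= i < n.+1)%N)
   b i * schauder_fun (w 0%N) (w i.-1) (w i) t) (w j) (w j.+1).
  apply: affine_between_sum => i iN; apply: affine_betweenZ.
  apply: schauder_fun_affine; [exact: node1|exact: node2|].
  have [ij|ji] := leqP i j; first by apply: Or44; exact: w_le (ltnW jn).
  have [ij1|ij1] := eqVneq i j.+1.
    by apply: Or43; rewrite ij1/= !lexx.
  by apply: Or42; apply/andP; split; apply: w_le; move: iN ji ij1; lia.
by move=> [k [l H]]; exists k, l => r /H <-; rewrite /g /schauder_block big_nat_cond
  [RHS]big_nat_cond; apply: eq_bigl => i; rewrite andbT andbb.
Qed.

(** The coefficients are dual to the triangles: those with a smaller index
    vanish at the three nodes, and those with a larger index are affine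
    between w 0 and w i. *)
Lemma schauder_block_coef i : (2 <= i < n.+1)%N ->
  schauder_coef g (w 0%N) (w i.-1) (w i) = b i.
Proof.
move=> iN; rewrite /g /schauder_block schauder_coef_sum.
rewrite (big_rem i) ?mem_index_iota//= schauder_coef_fun ?node1 ?node2// mulr1.
rewrite big_seq_cond big1 ?addr0// => j; rewrite andbT => jr.
have jN : (2 <= j < n.+1)%N by move/mem_rem : jr; rewrite mem_index_iota.
have ji : j != i.
  by move: jr; rewrite mem_rem_uniq ?iota_uniq// inE => /andP[].
have [lt_ji|lt_ij] := ltnP j i; last first.
  rewrite (schauder_coef_affine (ltW (node1 iN)) (ltW (node2 iN))) ?mulr0//.
  apply: schauder_fun_affine; [exact: node1|exact: node2|apply: Or42].
  by rewrite lexx/=; apply: w_le; move: jN ji lt_ij; lia.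
rewrite (_ : schauder_coef _ _ _ _ = 0) ?mulr0//.
have := schauder_coef_affine (x := fun=> 0) (ltW (node1 iN)) (ltW (node2 iN)).
move=> <-; last by exists 0, 0 => r _; ring.
apply: schauder_coef_eq; rewrite schauder_fun_out ?node1 ?node2//.
- by left.
- right; apply: w_le; move: iN lt_ji; lia.
- right; apply: w_le; move: iN lt_ji; lia.
Qed.

Lemma schauder_block_lip (be L : R) s t :
  (forall i, (2 <= i < n.+1)%N -> `|b i| <= be) -> 0 <= L -> 0 <= be ->
  (forall j, (j < n)%N -> (w j.+1 - w j)^-1 <= L ^+ 2) ->
  `|g s - g t| <= n%:R * be * L * `|s - t|.
Proof.
move=> b_le L0 be0 wL; rewrite /g /schauder_block -sumrB.
apply: (le_trans (ler_norm_sum _ _ _)).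
apply: (@le_trans _ _ (\sum_(2 <= i < n.+1) be * L * `|s - t|)).
  rewrite big_nat_cond [leRHS]big_nat_cond; apply: ler_sum => i /andP[iN _].
  rewrite -mulrBr normrM -mulrA; apply: ler_pM => //; first exact: b_le.
  apply: schauder_fun_lip; rewrite ?node1 ?node2//.
    apply: le_trans (wL 0%N _); last by move: iN; lia.
    rewrite lef_pV2 ?posrE ?subr_gt0 ?node1 ?w_lt//; [|by move: iN; lia..].
    rewrite lerD2r; apply: w_le; by move: iN; lia.
  have := wL i.-1; rewrite prednK; last by move: iN; lia.
  by apply; move: iN; lia.
rewrite big_const_nat iter_addr_0 -[leLHS]mulr_natl -!mulrA.
apply: ler_wpM2r; first by rewrite !mulr_ge0.
by rewrite ler_nat; lia.
Qed.

Variables (d : R).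
Hypothesis d0 : 0 < d.
Hypothesis wd : forall j, (j < n)%N -> w j.+1 - w j <= d.

(** Each triangle takes its values between 0 and the square root of the
    largest step. *)
Lemma schauder_block_incr s t :
  `|g s - g t| <= Num.sqrt d * \sum_(2 <= i < n.+1) `|b i|.
Proof.
rewrite /g /schauder_block -sumrB mulr_sumr.
apply: (le_trans (ler_norm_sum _ _ _)).
rewrite big_nat_cond [leRHS]big_nat_cond; apply: ler_sum => i /andP[iN _].
rewrite -mulrBr normrM mulrC; apply: ler_wpM2r => //.
have := @schauder_fun_bounds R _ _ _ (node1 iN) (node2 iN).
move=> H; move: (H s) (H t) => /andP[s0 s1] /andP[t0 t1].
have dd : Num.sqrt (w i - w i.-1) <= Num.sqrt d.
  apply: ler_wsqrtr; have := @wd i.-1; rewrite prednK; last by move: iN; lia.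
  by apply; move: iN; lia.
by rewrite ler_norml; apply/andP; split; lra.
Qed.

Variable (be : R).
Hypothesis b_le : forall i, (2 <= i < n.+1)%N -> `|b i| <= be.

(** At w j only the triangles with index i > j are nonzero, and they are on
    their rising side: their values are W sqrt(z_i) with W = w j - w 0 and the
    z_i of telescoping sum at most 1 / W. Bounding W sqrt(z_i) by half of W^2
    z_i / sqrt d + sqrt d yields (W / sqrt d + (n - j) sqrt d) / 2, and W <= j
    d makes this at most n sqrt d / 2. *)
Lemma schauder_block_node j : (0 < j <= n)%N -> 0 <= be ->
  `|g (w j)| <= n%:R / 2 * Num.sqrt d * be.
Proof.
move=> /andP[j0 jn] be0; set W := fun i => w i - w 0%N.
have W0 i : (0 < i <= n)%N -> 0 < W i.
  by move=> /andP[i0 iN]; rewrite /W subr_gt0 w_lt.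
(* The squared slopes, whose sum telescopes. *)
pose z i := (W i.-1)^-1 - (W i)^-1.
have sd0 : 0 < Num.sqrt d by rewrite sqrtr_gt0.
have Wd k : (k <= n)%N -> W k <= k%:R * d.
  elim: k => [|k IH] kn; first by rewrite /W subrr mul0r.
  have := IH (ltnW kn); have := wd kn; rewrite /W -natr1 mulrDl mul1r; lra.
have -> : g (w j) = \sum_(j.+1 <= i < n.+1) b i * (W j * Num.sqrt (z i)).
  rewrite /g /schauder_block.
  have [jj|jj] := ltnP n j.+1.
    rewrite [RHS]big_geq; last by lia.
    rewrite big_nat_cond big1// => i /andP[iN _].
    rewrite schauder_fun_out ?mulr0 ?node1 ?node2//; right; apply: w_le => //.
    by move: iN jj; lia.
  rewrite (@big_cat_nat _ _ _ j.+1)/=; [|by lia|by lia].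
  rewrite [X in X + _]big_nat_cond big1 ?add0r => [|i /andP[iN _]]; last first.
    rewrite schauder_fun_out ?mulr0 ?node1 ?node2//; try by move: iN jj; lia.
    right; apply: w_le => //; move: iN; lia.
  rewrite big_nat_cond [RHS]big_nat_cond; apply: eq_bigr => i /andP[iN _].
  rewrite schauder_fun_rise ?node1 ?node2//; try by move: iN; lia.
  by rewrite !w_le//; move: iN; lia.
apply: (le_trans (ler_norm_sum _ _ _)).
have Wj := W0 j; rewrite j0 jn in Wj; move: (Wj isT) => {}Wj.
apply: (@le_trans _ _ (\sum_(j.+1 <= i < n.+1)
     be * (2^-1 * (W j ^+ 2 / Num.sqrt d * z i + Num.sqrt d)))).
  rewrite big_nat_cond [leRHS]big_nat_cond; apply: ler_sum => i /andP[iN _].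
  have zi : 0 <= z i.
    rewrite /z subr_ge0 lef_pV2 ?posrE ?W0//; try by move: iN; lia.
    by rewrite /W lerD2r w_le//; move: iN; lia.
  rewrite normrM; apply: ler_pM => //; first by apply: b_le; move: iN j0; lia.
  rewrite normrM (gtr0_norm Wj) ger0_norm ?sqrtr_ge0//.
  have := sqr_ge0 (W j * Num.sqrt (z i) - Num.sqrt d).
  rewrite sqrrB exprMn sqr_sqrtr// sqr_sqrtr ?(ltW d0)// => H.
  rewrite -(ler_pM2r sd0).
  have -> : 2^-1 * (W j ^+ 2 / Num.sqrt d * z i + Num.sqrt d) * Num.sqrt d =
    2^-1 * (W j ^+ 2 * z i + Num.sqrt d ^+ 2) by field; rewrite gt_eqF.
  rewrite sqr_sqrtr ?(ltW d0)//; move: H; rewrite mulr2n; lra.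
rewrite -mulr_sumr mulrC; apply: ler_wpM2r => //.
rewrite -mulr_sumr big_split/= -mulr_sumr big_const_nat iter_addr_0.
rewrite subSS -[Num.sqrt d *+ _]mulr_natl natrB//.
have zsum : \sum_(j.+1 <= i < n.+1) z i <= (W j)^-1.
  have -> : \sum_(j.+1 <= i < n.+1) z i =
      \sum_(j.+1 <= i < n.+1) ((fun i => - (W i.-1)^-1) i.+1 - (fun i => - (W i.-1)^-1) i).
    by apply: eq_bigr => i _; rewrite /z/= opprK addrC.
  rewrite telescope_sumr//= opprK addrC lerBlDr lerDl.
  by rewrite invr_ge0 ltW// W0// leqnn (leq_trans j0 jn).
have : W j ^+ 2 / Num.sqrt d * \sum_(j.+1 <= i < n.+1) z i <= j%:R * Num.sqrt d.
  apply: (@le_trans _ _ (W j ^+ 2 / Num.sqrt d * (W j)^-1)).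
    by apply: ler_wpM2l => //; rewrite divr_ge0 ?sqr_ge0 ?ltW.
  have -> : W j ^+ 2 / Num.sqrt d * (W j)^-1 = W j / Num.sqrt d.
    by field; rewrite !gt_eqF.
  rewrite ler_pdivrMr// -mulrA -expr2 sqr_sqrtr ?(ltW d0)//; exact: Wd.
lra.
Qed.

Lemma schauder_block_sup t : 0 <= be -> `|g t| <= n%:R / 2 * Num.sqrt d * be.
Proof.
move=> be0; have rhs0 : 0 <= n%:R / 2 * Num.sqrt d * be.
  by rewrite !mulr_ge0 ?sqrtr_ge0.
have [tw|wt] := leP t (w 0%N).
  by rewrite schauder_block_out ?normr0//; left.
have [nt|tn] := leP (w n) t.
  by rewrite schauder_block_out ?normr0//; right.
have n0 : (0 < n)%N.
  by rewrite lt0n; apply: contraTneq wt => n0; rewrite -leNgt ltW// -n0.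
have [|j jn jt] := step_index (w := w) (t := t) n0; first by rewrite !ltW.
apply: affine_between_le (schauder_block_affine jn) jt _ _.
  have [->|j0] := posnP j; first by rewrite schauder_block_out ?normr0//; left.
  by apply: schauder_block_node => //; rewrite j0 ltnW.
exact: schauder_block_node.
Qed.

End Block.

(** * Refining partitions *)
Section Refining.
Context {R : realType} (T : R) (pi : nat -> seq R).
Hypothesis T0 : 0 < T.
Hypothesis hpi : refining_partitions T pi.

Let N n := size (pi n).

Lemma ptime_lt n i j : (i < j)%N -> (j <= N n)%N -> ptime pi n i < ptime pi n j.
Proof.
move=> ij jn; case: hpi => /(_ n)[sorted_pi _] _ _ _.
have s : sorted <%R (ppoints pi n) by [].
by apply: (sorted_ltn_nth lt_trans 0 s) => //; rewrite inE /= ltnS ?(leq_trans (ltnW ij)).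
Qed.

Lemma ptime_le n i j : (i <= j)%N -> (j <= N n)%N -> ptime pi n i <= ptime pi n j.
Proof.
by rewrite leq_eqVlt => /predU1P[->//|ij jn]; exact: ltW (ptime_lt ij jn).
Qed.

Lemma ptime_first n : ptime pi n 0 = 0. Proof. by []. Qed.

Lemma ptime_last n : ptime pi n (N n) = T.
Proof.
case: hpi => /(_ n)[_ /eqP <-] _ _ _.
by rewrite /ptime (last_nth 0).
Qed.

Lemma partition_size_gt0 n : (0 < N n)%N.
Proof.
rewrite lt0n; apply: contraTneq T0 => N0.
by rewrite -(ptime_last n) N0 ltxx.
Qed.

Lemma ptime_itv n i : (i <= N n)%N -> 0 <= ptime pi n i <= T.
Proof. by move=> iN; rewrite -(ptime_first n) -(ptime_last n) !ptime_le. Qed.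

Lemma ptime_inj n i j : (i <= N n)%N -> (j <= N n)%N ->
  ptime pi n i = ptime pi n j -> i = j.
Proof.
move=> iN jN e; case: (ltngtP i j) => // ij.
- by have := ptime_lt ij jN; rewrite e ltxx.
- by have := ptime_lt ij iN; rewrite e ltxx.
Qed.

(** The infimum that defines the index is attained at the point itself,
    because the next partition contains it. *)
Lemma pindexP m k : (k <= N m)%N ->
  ptime pi m.+1 (pindex pi m k) = ptime pi m k /\ (pindex pi m k <= N m.+1)%N.
Proof.
move=> kN; set t := ptime pi m k; set s := ppoints pi m.+1.
have ts : t \in s.
  by case: hpi => _ _ /(_ m) + _; apply; rewrite mem_nth//= ltnS.
have js : (index t s < size s)%N by rewrite index_mem.
have nj : nth 0 s (index t s) = t by exact: nth_index.
have hs : has (fun r => t <= r) s by apply/hasP; exists t.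
have fj : (pindex pi m k <= index t s)%N.
  rewrite leqNgt; apply/negP => /(before_find 0).
  by rewrite -/t -/s nj lexx.
have fN : (pindex pi m k <= N m.+1)%N by rewrite -ltnS (leq_ltn_trans fj).
split=> //; apply/eqP; rewrite eq_le; apply/andP; split.
  by rewrite -nj; apply: ptime_le => //; move: js; rewrite /= ltnS.
exact: (nth_find 0 hs).
Qed.

Lemma ptime_pindex m k : (k <= N m)%N ->
  ptime pi m.+1 (pindex pi m k) = ptime pi m k.
Proof. by case/pindexP. Qed.

Lemma pindex_le m k : (k <= N m)%N -> (pindex pi m k <= N m.+1)%N.
Proof. by case/pindexP. Qed.

Lemma pindex_lt m k l : (k < l)%N -> (l <= N m)%N ->
  (pindex pi m k < pindex pi m l)%N.
Proof.
move=> kl lN; have kN : (k <= N m)%N by lia.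
rewrite ltnNge; apply/negP => /(ptime_le)/(_ (pindex_le kN)).
by rewrite !ptime_pindex// leNgt ptime_lt.
Qed.

Lemma pindex0 m : pindex pi m 0 = 0%N.
Proof. by rewrite /pindex /= lexx. Qed.

Lemma pindex_last m : pindex pi m (N m) = N m.+1.
Proof.
apply: (@ptime_inj m.+1); rewrite ?pindex_le//.
by rewrite ptime_pindex// !ptime_last.
Qed.

Lemma nsub_gt0 m k : (k < N m)%N -> (0 < nsub pi m k)%N.
Proof. by move=> kN; rewrite /nsub subn_gt0 pindex_lt. Qed.

Lemma pindexS m k : (k < N m)%N ->
  (pindex pi m k + nsub pi m k)%N = pindex pi m k.+1.
Proof. by move=> kN; rewrite /nsub subnKC// ltnW// pindex_lt. Qed.

Lemma sum_over_blocks (V : nmodType) (F : nat -> V) m :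
  \sum_(j < N m.+1) F j =
  \sum_(k < N m) \sum_(i < nsub pi m k) F (pindex pi m k + i)%N.
Proof.
suff H k : (k <= N m)%N -> \sum_(j < pindex pi m k) F j =
  \sum_(l < k) \sum_(i < nsub pi m l) F (pindex pi m l + i)%N.
  by rewrite -pindex_last H.
elim: k => [|k IH] kN; first by rewrite pindex0 !big_ord0.
by rewrite big_ord_recr/= -IH 1?ltnW// -pindexS// big_split_ord.
Qed.

Lemma sum_nsub m : (\sum_(k < N m) nsub pi m k)%N = N m.+1.
Proof.
have := @sum_over_blocks nat (fun=> 1%N) m.
rewrite sum1_card card_ord => ->; apply: eq_bigr => k _.
by rewrite sum_nat_const card_ord muln1.
Qed.

Lemma block_of m j : (j < N m.+1)%N -> exists2 k, (k < N m)%N &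
  exists2 i, (i < nsub pi m k)%N & j = (pindex pi m k + i)%N.
Proof.
suff H k : (k <= N m)%N -> (j < pindex pi m k)%N -> exists2 l, (l < k)%N &
  exists2 i, (i < nsub pi m l)%N & j = (pindex pi m l + i)%N.
  by rewrite -pindex_last => jN; exact: H jN.
elim: k => [|k IH] kN; first by rewrite pindex0.
move=> jk; have [jk'|kj] := ltnP j (pindex pi m k).
  have [l lk H] := IH (ltnW kN) jk'; exists l => //; exact: ltnW.
exists k => //; exists (j - pindex pi m k)%N; rewrite ?subnKC//.
by rewrite /nsub ltn_sub2r// pindex_lt.
Qed.

Definition subnode m k i : R := ptime pi m.+1 (pindex pi m k + i).

Lemma block_first m k : (k < N m)%N -> subnode m k 0 = ptime pi m k.
Proof. by move=> kN; rewrite /subnode addn0 ptime_pindex// ltnW. Qed.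

Lemma block_last m k : (k < N m)%N -> subnode m k (nsub pi m k) = ptime pi m k.+1.
Proof. by move=> kN; rewrite /subnode pindexS// ptime_pindex. Qed.

Lemma block_index_le m k i : (k < N m)%N -> (i <= nsub pi m k)%N ->
  (pindex pi m k + i <= N m.+1)%N.
Proof.
move=> kN iN; apply: (leq_trans _ (pindex_le kN)).
by rewrite -pindexS// leq_add2l.
Qed.

Lemma block_lt m k i j : (k < N m)%N -> (i < j)%N -> (j <= nsub pi m k)%N ->
  subnode m k i < subnode m k j.
Proof.
by move=> kN ij jN; apply: ptime_lt; rewrite ?ltn_add2l// block_index_le.
Qed.

Lemma ptime_step n t : 0 <= t <= T ->
  exists2 j, (j < N n)%N & ptime pi n j <= t <= ptime pi n j.+1.
Proof.
move=> tT; apply: step_index; first exact: partition_size_gt0.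
by rewrite ptime_last.
Qed.

Lemma ptime_next n l i : (i <= N n)%N ->
  exists2 j, (j <= N (n + l))%N & ptime pi (n + l) j = ptime pi n i.
Proof.
move=> iN; elim: l => [|l [j jN <-]]; first by exists i; rewrite ?addn0.
by rewrite addnS; exists (pindex pi (n + l) j); rewrite ?pindex_le ?ptime_pindex.
Qed.

Let step n j := ptime pi n j.+1 - ptime pi n j.

Lemma step_gt0 n j : (j < N n)%N -> 0 < step n j.
Proof. by move=> jN; rewrite subr_gt0 ptime_lt. Qed.

Let psteps_step n j : (j < N n)%N -> psteps pi n (step n j).
Proof. by move=> jN; exists j => //=; rewrite ger0_norm// ltW// step_gt0. Qed.

Let psteps_le n r : psteps pi n r -> 0 < r <= T.
Proof.
move=> [j /= jN <-]; rewrite gtr0_norm ?step_gt0//=.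
have /andP[j0 _] := ptime_itv (ltnW jN); have /andP[_ jT] := ptime_itv jN.
lra.
Qed.

Lemma step_le_mesh n j : (j < N n)%N -> step n j <= mesh pi n.
Proof.
move=> jN; apply: ub_le_sup; last exact: psteps_step.
by exists T => r /psteps_le/andP[].
Qed.

Lemma mesh_gt0 n : 0 < mesh pi n.
Proof.
apply: (lt_le_trans (step_gt0 (partition_size_gt0 n))).
exact: (step_le_mesh (partition_size_gt0 n)).
Qed.

Lemma min_mesh_le_step n j : (j < N n)%N -> min_mesh pi n <= step n j.
Proof.
move=> jN; apply: ge_inf; last exact: psteps_step.
by exists 0 => r /psteps_le/andP[/ltW].
Qed.

(** The steps are positive and finitely many, so their infimum is positive. *)
Lemma min_mesh_gt0 n : 0 < min_mesh pi n.
Proof.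
have H k : (k < N n)%N -> exists2 e : R, 0 < e & forall j, (j <= k)%N -> e <= step n j.
  elim: k => [|k IH] kN.
    by exists (step n 0); [exact: step_gt0|case].
  have [e e0 He] := IH (ltnW kN); exists (Num.min e (step n k.+1)).
    by rewrite lt_min e0 step_gt0.
  move=> j; rewrite leq_eqVlt => /predU1P[->|jk].
    by rewrite ge_min lexx orbT.
  by rewrite ge_min He.
have [|e e0 He] := H (N n).-1; first by rewrite prednK ?partition_size_gt0.
apply: (lt_le_trans e0); apply: lb_le_inf.
  by exists (step n 0); apply: psteps_step; exact: partition_size_gt0.
move=> r [j /= jN <-]; rewrite gtr0_norm ?step_gt0//; apply: He.
by rewrite -ltnS prednK ?partition_size_gt0.
Qed.

Lemma partition_points_dense t e : 0 <= t <= T -> 0 < e ->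
  exists n j, [/\ (j <= N n)%N & `|ptime pi n j - t| < e].
Proof.
move=> tT e0; have : \forall n \near \oo, `|0 - mesh pi n| < e.
  by case: hpi => _ _ _ /cvgrPdist_lt; apply.
move=> [n _ /(_ n (leqnn n))] /=; rewrite sub0r normrN gtr0_norm ?mesh_gt0// => me.
have [j jN /andP[jt tj]] := ptime_step n tT.
exists n, j; split; first exact: ltnW.
rewrite distrC ger0_norm ?subr_ge0//; apply: le_lt_trans me.
by apply: le_trans (step_le_mesh jN); rewrite lerD2r.
Qed.

End Refining.

(** * Size of one Schauder coefficient *)
Section CoefficientBounds.
Context {R : realType}.
Implicit Types (u v h d c al : R) (x : R -> R).

Lemma le_sqrt (y z : R) : 0 <= y -> y ^+ 2 <= z -> y <= Num.sqrt z.
Proof. by move=> y0 yz; rewrite -(ger0_norm y0) -sqrtr_sqr ler_wsqrtr. Qed.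

Lemma triple_root_gt0 u v : 0 < u -> 0 < v -> 0 < Num.sqrt (u * v * (u + v)).
Proof. by move=> u0 v0; rewrite sqrtr_gt0 !mulr_gt0// addr_gt0. Qed.

Lemma div_triple_root u v : 0 < u -> 0 < v ->
  u / Num.sqrt (u * v * (u + v)) <= (Num.sqrt v)^-1.
Proof.
move=> u0 v0; have D0 := triple_root_gt0 u0 v0.
have sv : 0 < Num.sqrt v by rewrite sqrtr_gt0.
rewrite ler_pdivrMr// mulrC ler_pdivlMr//.
apply: le_sqrt; first by rewrite mulr_ge0 ?ltW.
rewrite exprMn sqr_sqrtr ?(ltW v0)// expr2 -!mulrA ler_wpM2l ?(ltW u0)//.
by rewrite mulrC ler_wpM2l ?(ltW v0)// lerDl ltW.
Qed.

(** Interpolates u + v = (u + v)^(2 al - 1) (u + v)^(2 - 2 al), and bounds the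
    first factor below by a power of u and the second one by a power of v.
    Thus an exponent al above 1 / 2 costs no factor even if u is much longer
    than v. *)
Lemma powR_div_triple_root u v al : 0 < u -> 0 < v -> 2^-1 <= al <= 1 ->
  u `^ al * v / Num.sqrt (u * v * (u + v)) <= v `^ al / Num.sqrt v.
Proof.
move=> u0 v0 /andP[al2 al1]; have D0 := triple_root_gt0 u0 v0.
have sv : 0 < Num.sqrt v by rewrite sqrtr_gt0.
have va : 0 < v `^ al by rewrite powR_gt0.
have ua : 0 < u `^ al by rewrite powR_gt0.
rewrite ler_pdivrMr// mulrAC ler_pdivlMr//.
rewrite -ler_pdivrMl//; apply: le_sqrt.
  by rewrite !mulr_ge0 ?invr_ge0 ?ltW.
have uv0 : 0 < u + v by rewrite addr_gt0.
have key : u `^ (2 * al - 1) * v `^ (2 - 2 * al) <= u + v.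
  rewrite -[leRHS]powRr1 ?(ltW uv0)//.
  rewrite [X in _ <= _ `^ X](_ : 1 = (2 * al - 1) + (2 - 2 * al)); last by ring.
  rewrite [leRHS]powRD ?(gt_eqF uv0) ?implybT//.
  by apply: ler_pM; rewrite ?powR_ge0//; apply: ge0_ler_powR;
    rewrite ?nnegrE ?(ltW u0) ?(ltW v0) ?(ltW uv0)//; lra.
have sq (y : R) : 0 < y -> (y `^ al) ^+ 2 = y `^ (2 * al).
  by move=> y0; rewrite -powR_mulrn ?powR_ge0// -powRrM mulrC.
have E (y r : R) : 0 < y -> y `^ (2 * al) = y `^ (2 * al - 1) * y.
  move=> y0; rewrite -[X in _ = _ * X]powRr1 ?(ltW y0)// -powRD ?subrK//.
  by rewrite (gt_eqF y0) implybT.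
rewrite !exprMn exprVn !sq// sqr_sqrtr ?(ltW v0)//.
apply: (@le_trans _ _ (u * v * (u `^ (2 * al - 1) * v `^ (2 - 2 * al)))); last first.
  by rewrite ler_wpM2l ?mulr_ge0 ?(ltW u0) ?(ltW v0).
rewrite (E u 0)// -powRN le_eqVlt; apply/orP; left; apply/eqP.
have -> : v `^ (2 - 2 * al) = v `^ (- (2 * al)) * v ^+ 2.
  rewrite -powR_mulrn ?(ltW v0)// -powRD ?(gt_eqF v0) ?implybT//.
  by congr powR; ring.
by ring.
Qed.

(** The quotient is y^(al - 1 / 2). For al <= 1 / 2 it is decreasing in y and
    y >= d / c is used; for larger al it is increasing and y <= d is used. *)
Lemma scaled_powR_le d c y al : 1 < c -> 0 < d -> d <= c * y -> 0 <= al ->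
  (al <= 2^-1 \/ (y <= d /\ al <= 1)) ->
  d `^ (1 / 2 - al) * (y `^ al / Num.sqrt y) <= Num.sqrt c ^+ 3.
Proof.
move=> c1 d0 dcy al0 H.
have c0 : 0 < c by lra.
have y0 : 0 < y by rewrite -(pmulr_rgt0 _ c0) (lt_le_trans d0).
have sc : 1 <= Num.sqrt c by rewrite -sqrtr1 ler_wsqrtr// ltW.
have -> : y `^ al / Num.sqrt y = y `^ (al - 2^-1).
  by rewrite powRB ?(gt_eqF y0) ?implybT// powR12_sqrt// ltW.
have -> : d `^ (1 / 2 - al) * y `^ (al - 2^-1) = (d / y) `^ (2^-1 - al).
  rewrite powRM ?invr_ge0 ?(ltW y0) ?(ltW d0)// div1r; congr (_ * _).
  by rewrite -[X in _ = X `^ _](powR_inv1 (ltW y0)) -powRrM; congr powR; ring.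
have dy0 : 0 < d / y by rewrite divr_gt0.
case: H => [al2|[yd al1]].
  apply: (@le_trans _ _ (c `^ (2^-1 - al))).
    apply: ge0_ler_powR; rewrite ?subr_ge0// ?nnegrE ?(ltW c0) ?(ltW dy0)//.
    by rewrite ler_pdivrMr.
  apply: (@le_trans _ _ (c `^ 2^-1)).
    by apply: ler_powR; rewrite ?(ltW c1)//; lra.
  by rewrite powR12_sqrt ?(ltW c0)// ler_eXnr.
have [al2|al2] := leP al 2^-1.
  apply: (@le_trans _ _ (c `^ (2^-1 - al))).
    apply: ge0_ler_powR; rewrite ?subr_ge0// ?nnegrE ?(ltW c0) ?(ltW dy0)//.
    by rewrite ler_pdivrMr.
  apply: (@le_trans _ _ (c `^ 2^-1)).
    by apply: ler_powR; rewrite ?(ltW c1)//; lra.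
  by rewrite powR12_sqrt ?(ltW c0)// ler_eXnr.
apply: (@le_trans _ _ 1); last exact: exprn_ege1.
rewrite -[leRHS](powRr0 (d / y)); apply: ler_powR; last by lra.
by rewrite ler_pdivlMr// mul1r.
Qed.

(** The distance from t1 to t2 may span several steps, so only t3 - t2 is
    assumed to be at most the mesh d. *)
Lemma schauder_coef_Holder x t1 t2 t3 al c d h : 0 < al < 1 -> 1 < c ->
  t1 < t2 -> t2 < t3 -> d <= c * (t2 - t1) -> d <= c * (t3 - t2) ->
  t3 - t2 <= d ->
  `|x t2 - x t1| <= h * `|t2 - t1| `^ al -> `|x t3 - x t2| <= h * `|t3 - t2| `^ al ->
  d `^ (1 / 2 - al) * `|schauder_coef x t1 t2 t3| <= 2 * Num.sqrt c ^+ 3 * h.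
Proof.
move=> /andP[al0 al1] c1 t12 t23 du dv vd.
rewrite /schauder_coef.
have -> : t3 - t1 = (t2 - t1) + (t3 - t2) by ring.
move: du dv vd; have : 0 < t2 - t1 by rewrite subr_gt0.
have : 0 < t3 - t2 by rewrite subr_gt0.
set u := t2 - t1; set v := t3 - t2 => v0 u0 du dv vd.
rewrite (gtr0_norm u0) (gtr0_norm v0); set X := x t2 - x t1; set Y := x t3 - x t2 => hX hY.
have d0 : 0 < d := lt_le_trans v0 vd.
have D0 := triple_root_gt0 u0 v0; set D := Num.sqrt _ in D0 *.
have h0 : 0 <= h.
  by rewrite -(pmulr_lge0 _ (powR_gt0 al u0)) (le_trans _ hX).
have A1 : u / D <= (Num.sqrt v)^-1 by exact: div_triple_root.
have A2 : v / D <= (Num.sqrt u)^-1.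
  have -> : D = Num.sqrt (v * u * (v + u)) by rewrite /D [v * u]mulrC [v + u]addrC.
  exact: div_triple_root.
have B2 : d `^ (1 / 2 - al) * (v `^ al * u / D) <= Num.sqrt c ^+ 3.
  apply: le_trans (scaled_powR_le c1 d0 dv (ltW al0) _); last by right; rewrite (ltW al1).
  by apply: ler_wpM2l; rewrite ?powR_ge0// -mulrA ler_wpM2l ?powR_ge0.
have B1 : d `^ (1 / 2 - al) * (u `^ al * v / D) <= Num.sqrt c ^+ 3.
  have [al2|al2] := leP al 2^-1.
    apply: le_trans (scaled_powR_le c1 d0 du (ltW al0) _); last by left.
    by apply: ler_wpM2l; rewrite ?powR_ge0// -mulrA ler_wpM2l ?powR_ge0.
  apply: le_trans (scaled_powR_le c1 d0 dv (ltW al0) _); last by right; rewrite (ltW al1).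
  apply: ler_wpM2l; rewrite ?powR_ge0//; apply: powR_div_triple_root => //.
  by rewrite (ltW al1) (ltW al2).
have -> : `|(X * v - Y * u) / D| = `|X * v - Y * u| / D.
  by rewrite normrM normfV (gtr0_norm D0).
apply: (@le_trans _ _ (d `^ (1 / 2 - al) * ((h * u `^ al * v + h * v `^ al * u) / D))).
  apply: ler_wpM2l; rewrite ?powR_ge0// ler_wpM2r ?invr_ge0 ?(ltW D0)//.
  apply: (le_trans (ler_normB _ _)); rewrite !normrM (gtr0_norm u0) (gtr0_norm v0).
  by apply: lerD; apply: ler_wpM2r; rewrite ?(ltW u0) ?(ltW v0).
have -> : d `^ (1 / 2 - al) * ((h * u `^ al * v + h * v `^ al * u) / D) =
  h * (d `^ (1 / 2 - al) * (u `^ al * v / D) + d `^ (1 / 2 - al) * (v `^ al * u / D)).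
  by ring.
rewrite [leRHS]mulrC; apply: ler_wpM2l => //; lra.
Qed.

Lemma schauder_coef_incr x (t1 t2 t3 e : R) : 0 < e -> e <= t2 - t1 -> e <= t3 - t2 ->
  `|schauder_coef x t1 t2 t3| <= (Num.sqrt e)^-1 * (`|x t2 - x t1| + `|x t3 - x t2|).
Proof.
move=> e0 eu ev; rewrite /schauder_coef.
have -> : t3 - t1 = (t2 - t1) + (t3 - t2) by ring.
set u := t2 - t1 in eu *; set v := t3 - t2 in ev *.
have u0 : 0 < u := lt_le_trans e0 eu.
have v0 : 0 < v := lt_le_trans e0 ev.
have D0 := triple_root_gt0 u0 v0; set D := Num.sqrt (u * _ * _) in D0 *.
have A1 : u / D <= (Num.sqrt v)^-1 by exact: div_triple_root.
have A2 : v / D <= (Num.sqrt u)^-1.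
  have -> : D = Num.sqrt (v * u * (v + u)) by rewrite /D [v * u]mulrC [v + u]addrC.
  exact: div_triple_root.
have es (y : R) : e <= y -> (Num.sqrt y)^-1 <= (Num.sqrt e)^-1.
  move=> ey; rewrite lef_pV2 ?posrE ?sqrtr_gt0 ?ler_wsqrtr//.
  exact: lt_le_trans ey.
rewrite mulrBl; apply: (le_trans (ler_normB _ _)).
rewrite -!mulrA !normrM -/(v / D) mulrDr ![(Num.sqrt e)^-1 * _]mulrC.
rewrite (gtr0_norm v0) (gtr0_norm u0) normfV (gtr0_norm D0).
by apply: lerD; apply: ler_wpM2l => //; [apply: le_trans A2 (es _ _)|apply: le_trans A1 (es _ _)].
Qed.

End CoefficientBounds.

(** * Coefficient matrices indexed by pairs *)
Section Indices.
Context {R : realType} (pi : nat -> seq R).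

Lemma thetaE (x : R -> R) m k i : (0 < i)%N ->
  theta pi x m k i = schauder_coef x (subnode pi m k 0) (subnode pi m k i.-1) (subnode pi m k i).
Proof. by case: i => // i _; rewrite /theta /schauder_coef /subnode addn0 addnS subn1. Qed.

Lemma sum_theta_indices (V : nmodType) (F : nat * nat -> V) m :
  \sum_(ki <- theta_indices pi m) F ki =
  \sum_(k < size (pi m)) \sum_(2 <= i < (nsub pi m k).+1) F (val k, i).
Proof.
rewrite /theta_indices big_allpairs_dep /=.
have -> : iota 0 (size (pi m)) = index_iota 0 (size (pi m)) by rewrite /index_iota subn0.
rewrite big_mkord.
by apply: eq_bigr => k _; rewrite /index_iota subSS.
Qed.

Lemma mem_theta_indices m k i :
  ((k, i) \in theta_indices pi m) = (k < size (pi m))%N && (2 <= i < (nsub pi m k).+1)%N.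
Proof.
apply/allpairsPdep/idP => [[k' [i' [+ + [-> ->]]]]|/andP[kN iN]].
  by rewrite !mem_iota; lia.
exists k, i; rewrite !mem_iota; split=> //; move: iN; lia.
Qed.

End Indices.

Section Norms.
Context {R : realType} (T : R) (pi : nat -> seq R) (e : nat -> seq (nat * nat)).
Hypothesis T0 : 0 < T.
Hypothesis hpi : refining_partitions T pi.
Hypothesis he : schauder_order pi e.

(** An interval cut into n pieces contributes n - 1 pairs, and n - 1 new
    partition points. *)
Lemma size_theta_indices m : size (theta_indices pi m) = cardI pi m.
Proof.
have -> : size (theta_indices pi m) = (\sum_(k < size (pi m)) (nsub pi m k - 1))%N.
  rewrite -sum1_size; apply: (etrans (@sum_theta_indices _ pi nat (fun=> 1%N) m)).
  by apply: eq_bigr => k _; apply: (etrans (sum_nat_const_nat _ _ _)); rewrite muln1 subSS.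
have H : (\sum_(k < size (pi m)) (nsub pi m k - 1) + size (pi m) = size (pi m.+1))%N.
  rewrite -(sum_nsub T0 hpi) -[X in (_ + X)%N]card_ord -sum1_card -big_split/=.
  by apply: eq_bigr => k _; rewrite subnK// (nsub_gt0 T0 hpi).
by rewrite /cardI -H addnK.
Qed.

Lemma size_order m : size (e m) = cardI pi m.
Proof. by rewrite (perm_size (he m)) size_theta_indices. Qed.

Lemma sum_order (V : nmodType) (F : nat * nat -> V) m :
  \sum_(l < cardI pi m) F (nth (0, 0)%N (e m) l) =
  \sum_(k < size (pi m)) \sum_(2 <= i < (nsub pi m k).+1) F (val k, i).
Proof.
rewrite -sum_theta_indices -(perm_big _ (he m)) (big_nth (0, 0)%N).
by rewrite size_order big_mkord.
Qed.

Lemma nth_orderP m l : (l < cardI pi m)%N ->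
  exists k i, [/\ nth (0, 0)%N (e m) l = (k, i), (k < size (pi m))%N &
     (2 <= i < (nsub pi m k).+1)%N].
Proof.
rewrite -size_order => /(mem_nth (0, 0)%N).
rewrite (perm_mem (he m)); case: (nth _ _ _) => k i.
by rewrite mem_theta_indices => /andP[kN iN]; exists k, i.
Qed.

Lemma ThetaE (x : R -> R) m l : (l < cardI pi m)%N ->
  Theta pi e x m l =
   theta pi x m (nth (0, 0)%N (e m) l).1 (nth (0, 0)%N (e m) l).2.
Proof. by rewrite /Theta => ->. Qed.

Lemma Theta_Mpi (x : R -> R) : Mpi pi (Theta pi e x).
Proof. by move=> m l ml; rewrite /Theta ltnNge ml. Qed.

Lemma mx_p_normE (p : R) (A : nat -> nat -> R) : 0 < p -> Mpi pi A ->
  mx_p_norm pi p A = ereal_sup (range (fun m : nat =>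
    (mesh pi m `^ (1 / 2) * (\sum_(l < cardI pi m) `|A m l| `^ p) `^ p^-1)%:E)).
Proof.
move=> p0 MA; rewrite /mx_p_norm; congr (ereal_sup (_ @` _)).
apply/funext => m; rewrite EFinM; congr (_ * _)%E.
rewrite -poweR_EFin; congr (poweR _ _).
rewrite (@nneseries_split _ _ 0 (cardI pi m)); last first.
  by move=> k _; rewrite lee_fin powR_ge0.
rewrite add0n eseries0 ?adde0; first by rewrite -sumEFin big_mkord.
by move=> k km _; rewrite MA// normr0 powR0// gt_eqF.
Qed.

Lemma Theta_comb (k : R) (x y : R -> R) :
  Theta pi e (k *: x + y) = k *: Theta pi e x + Theta pi e y.
Proof.
apply/funext => m; apply/funext => l.
rewrite /Theta /theta !fctE; case: ifP => _.
  rewrite /GRing.scale/=; ring.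
by rewrite scaler0 addr0.
Qed.

End Norms.

(** * A function is determined by its coefficients *)
Section Injectivity.
Context {R : realType} (T : R) (pi : nat -> seq R).
Hypothesis T0 : 0 < T.
Hypothesis hpi : refining_partitions T pi.
Let N n := size (pi n).

(** Inside a subdivided interval at whose left end the function vanishes, a
    zero coefficient and a zero at the i-th node force a zero at the previous
    node; so zeros propagate from the right end to the whole block. *)
Lemma theta_eq0_nodes (z : R -> R) : z 0 = 0 -> z T = 0 ->
  (forall m k i, (k < N m)%N -> (2 <= i < (nsub pi m k).+1)%N -> theta pi z m k i = 0) ->
  forall n j, (j <= N n)%N -> z (ptime pi n j) = 0.
Proof.
move=> z0 zT H; elim=> [|m IH] j jN.
  case: hpi jN => _ p0 _ _; rewrite /N p0 /ptime /ppoints p0.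
  by case: j => [|[|]].
move: jN; rewrite leq_eqVlt => /predU1P[->|/(block_of T0 hpi)].
  by rewrite (ptime_last hpi).
move=> [k kN [i iN ->]]; rewrite -/(subnode pi m k i).
have zn : z (subnode pi m k (nsub pi m k)) = 0.
  by rewrite (block_last T0 hpi)// IH.
have [->|i0] := posnP i.
  by rewrite (block_first hpi)// IH// ltnW.
suff D l : (l < nsub pi m k)%N -> z (subnode pi m k (nsub pi m k - l)) = 0.
  by have := D (nsub pi m k - i)%N; rewrite subKn ?(ltnW iN)//; apply; lia.
elim: l => [|l IHl] lN; first by rewrite subn0.
have := H m k (nsub pi m k - l)%N kN; rewrite thetaE; last by lia.
have -> : ((nsub pi m k - l).-1 = nsub pi m k - l.+1)%N by lia.
move: IHl => /(_ (ltnW lN)).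
have l0 : z (subnode pi m k 0) = 0 by rewrite (block_first hpi)// IH// ltnW.
have := @block_lt R T pi T0 hpi m k 0 (nsub pi m k - l.+1)%N kN.
have := @block_lt R T pi T0 hpi m k (nsub pi m k - l.+1)%N (nsub pi m k - l)%N kN.
move: l0; rewrite /schauder_coef.
set t1 := subnode pi m k 0; set t2 := subnode pi m k (_ - _.+1); set t3 := subnode _ _ _ _.
move=> -> /(_ ltac:(lia) ltac:(lia)) t23 /(_ ltac:(lia) ltac:(lia)) t12 -> /(_ ltac:(lia)).
move/eqP; rewrite mulf_eq0 invr_eq0 => /orP[|]; last first.
  by rewrite gt_eqF// sqrtr_gt0 !mulr_gt0 ?subr_gt0// (lt_trans t12).
rewrite subr0 sub0r mulNr opprK -mulrDr mulf_eq0 => /orP[/eqP//|].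
by rewrite gt_eqF//; lra.
Qed.

Lemma theta_eq0 (z : R -> R) : C0 T z -> vanish_at_ends T z ->
  (forall m k i, (k < N m)%N -> (2 <= i < (nsub pi m k).+1)%N -> theta pi z m k i = 0) ->
  forall t, z t = 0.
Proof.
move=> [zc zout] [z0 zT] H t; have [tT|tT] := boolP (t \in `[0, T]); last first.
  exact: zout.
have nodes := theta_eq0_nodes z0 zT H.
apply/eqP/negPn/negP => zt.
have zt0 : 0 < `|z t| by rewrite normr_gt0.
have /(_ t) := proj1 (subspace_continuousP _ _) zc; rewrite /= tT => /(_ isT).
move=> /cvgrPdist_lt/(_ _ zt0); rewrite near_withinE => /nbhs_ballP[d /= d0 dH].
move: tT; rewrite in_itv/= => tT.
have [n [j [jN jt]]] := partition_points_dense T0 hpi tT d0.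
have := dH (ptime pi n j); rewrite /ball/= distrC => /(_ jt).
rewrite in_itv/= (ptime_itv hpi)// => /(_ isT).
by rewrite /from_subspace nodes// subr0 ltxx.
Qed.

End Injectivity.

(** * Bounds on the coefficient matrix *)
Section Forward.
Context {R : realType} (T : R) (pi : nat -> seq R) (M : nat) (c a b : R)
  (e : nat -> seq (nat * nat)).
Hypothesis T0 : 0 < T.
Hypothesis hpi : refining_partitions T pi.
Hypothesis hbal : balanced pi c.
Hypothesis href : complete_refining pi M a b.
Hypothesis he : schauder_order pi e.

Let N n := size (pi n).

Lemma balance_gt1 : 1 < c. Proof. by case: hbal. Qed.
Lemma balance_gt0 : 0 < c. Proof. exact: lt_trans balance_gt1. Qed.
Let c0 := balance_gt0.

Lemma nsub_le m k : (k < N m)%N -> (nsub pi m k <= M)%N.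
Proof. by case: href => -[_ H] _ _ _; exact: H. Qed.

Lemma refinement_gt0 : (0 < M)%N. Proof. by case: href => -[]. Qed.

Lemma decay_gt0 : 0 < a. Proof. by case: href. Qed.

Lemma mesh_decay m : (1 + a) * mesh pi m.+1 <= mesh pi m.
Proof.
case: href => _ _ _ /(_ m)/andP[+ _].
by rewrite ler_pdivlMr// (mesh_gt0 T0 hpi).
Qed.

Lemma mesh_le_next m : mesh pi m <= b * mesh pi m.+1.
Proof.
case: href => _ _ _ /(_ m)/andP[_].
by rewrite ler_pdivrMr// (mesh_gt0 T0 hpi).
Qed.

Lemma decay_le : 1 + a <= b.
Proof. by case: href => _ _ _ /(_ 0%N)/andP[+ +]; exact: le_trans. Qed.

Lemma mesh_le_step n j : (j < N n)%N ->
  mesh pi n <= c * (ptime pi n j.+1 - ptime pi n j).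
Proof.
move=> jN; case: hbal => _ /(_ n); rewrite ler_pdivrMr ?(min_mesh_gt0 T0 hpi)//.
move=> /le_trans; apply; apply: ler_wpM2l; first exact: ltW.
exact: (min_mesh_le_step hpi).
Qed.

Lemma block_step_le m k i : (k < N m)%N -> (i < nsub pi m k)%N ->
  subnode pi m k i.+1 - subnode pi m k i <= mesh pi m.+1.
Proof.
move=> kN iN; rewrite /subnode addnS; apply: (step_le_mesh hpi).
by have := block_index_le T0 hpi kN iN; rewrite addnS.
Qed.

Lemma mesh_le_block_step m k i : (k < N m)%N -> (i < nsub pi m k)%N ->
  mesh pi m.+1 <= c * (subnode pi m k i.+1 - subnode pi m k i).
Proof.
move=> kN iN; rewrite /subnode addnS; apply: mesh_le_step.
by have := block_index_le T0 hpi kN iN; rewrite addnS.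
Qed.

Lemma mesh_le_block m k i j : (k < N m)%N -> (i < j)%N -> (j <= nsub pi m k)%N ->
  mesh pi m.+1 <= c * (subnode pi m k j - subnode pi m k i).
Proof.
move=> kN ij jN; apply: le_trans (mesh_le_block_step kN (leq_trans ij jN)) _.
apply: ler_wpM2l; first exact: ltW.
rewrite lerD2r; move: ij; rewrite leq_eqVlt => /predU1P[->//|ij].
by apply: ltW; exact: (block_lt T0 hpi kN ij jN).
Qed.

Lemma block_itv m k i : (k < N m)%N -> (i <= nsub pi m k)%N ->
  0 <= subnode pi m k i <= T.
Proof. by move=> kN iN; apply: (ptime_itv hpi); exact: (block_index_le T0 hpi). Qed.

Lemma Theta_sup_le (x : R -> R) (al h : R) m l : 0 < al < 1 ->
  (forall s t, 0 <= s <= T -> 0 <= t <= T -> `|x s - x t| <= h * `|s - t| `^ al) ->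
  mesh pi m.+1 `^ (1 / 2 - al) * `|Theta pi e x m l| <= 2 * Num.sqrt c ^+ 3 * h.
Proof.
move=> al01 H.
have h0 : 0 <= h.
  have := H T 0; rewrite subr0 !lexx (ltW T0) => /(_ isT isT) hT.
  have P : 0 < `|T| `^ al by rewrite powR_gt0// normr_gt0 gt_eqF.
  by rewrite -(pmulr_lge0 _ P); exact: le_trans hT.
have [lI|lI] := ltnP l (cardI pi m); last first.
  rewrite (Theta_Mpi e x lI) normr0 mulr0 !mulr_ge0//.
rewrite ThetaE//; have [k [i [-> kN iN]]] := nth_orderP T0 hpi he lI.
rewrite /= thetaE; last by move: iN; lia.
have /andP[i2 iN'] := iN; rewrite ltnS in iN'.
have ii : (i.-1 < i)%N by lia.
have i1N : (i.-1 <= nsub pi m k)%N by lia.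
have i10 : (0 < i.-1)%N by lia.
apply: schauder_coef_Holder => //.
- exact: balance_gt1.
- exact: (block_lt T0 hpi).
- exact: (block_lt T0 hpi).
- exact: mesh_le_block.
- exact: mesh_le_block.
- have := @block_step_le m k i.-1 kN; rewrite prednK; last by lia.
  exact.
- by apply: H; apply: block_itv.
- by apply: H; apply: block_itv.
Qed.

Lemma increment_le_sum (x : R -> R) (w : nat -> R) i n : (i <= n)%N ->
  `|x (w i) - x (w 0%N)| <= \sum_(j < i) `|x (w j.+1) - x (w j)|.
Proof.
elim: i => [|i IH] iN; first by rewrite subrr normr0 big_ord0.
rewrite big_ord_recr/= [leRHS]addrC.
have -> : x (w i.+1) - x (w 0%N) = (x (w i.+1) - x (w i)) + (x (w i) - x (w 0%N)) by ring.
by apply: (le_trans (ler_normD _ _)); rewrite lerD2l IH// ltnW.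
Qed.

Lemma pvar_blocks (p : R) (x : R -> R) m : pvar pi p m.+1 x =
  \sum_(k < N m) \sum_(i < nsub pi m k)
    `|x (subnode pi m k i.+1) - x (subnode pi m k i)| `^ p.
Proof.
rewrite /pvar (sum_over_blocks T0 hpi
  (fun j => `|x (ptime pi m.+1 j.+1) - x (ptime pi m.+1 j)| `^ p)).
by apply: eq_bigr => k _; apply: eq_bigr => i _; rewrite /subnode addnS.
Qed.

(** Each coefficient of a block is bounded by the sum of the absolute
    increments over this block. One factor M^(p - 1) comes from the power mean
    inequality and one factor M from the number of coefficients. *)
Lemma sum_Theta_powR_le (x : R -> R) p m : 1 < p ->
  \sum_(l < cardI pi m) `|Theta pi e x m l| `^ p <=
  (M%:R * (Num.sqrt (mesh pi m.+1 / c))^-1) `^ p * pvar pi p m.+1 x.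
Proof.
move=> p1; have p0 : 0 <= p by lra.
set Q := (Num.sqrt _)^-1.
have Q0 : 0 <= Q by rewrite invr_ge0 sqrtr_ge0.
have M0 : 0 < M%:R :> R by rewrite ltr0n refinement_gt0.
have mc0 : 0 < mesh pi m.+1 / c by rewrite divr_gt0 ?(mesh_gt0 T0 hpi).
under eq_bigr do rewrite ThetaE//.
rewrite (sum_order T0 hpi he (fun ki => `|theta pi x m ki.1 ki.2| `^ p)).
rewrite pvar_blocks mulr_sumr; apply: ler_sum => k _.
have kN := ltn_ord k.
pose dx j := `|x (subnode pi m k j.+1) - x (subnode pi m k j)|.
apply: (@le_trans _ _ (\sum_(2 <= i < (nsub pi m k).+1)
    (Q `^ p * (M%:R `^ (p - 1) * \sum_(j < nsub pi m k) dx j `^ p)))).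
  rewrite big_nat_cond [leRHS]big_nat_cond; apply: ler_sum => i /andP[iN _].
  have /andP[i2 iN'] := iN; rewrite ltnS in iN'.
  have ii : (i.-1 < i)%N by lia.
  have i1N : (i.-1 <= nsub pi m k)%N by lia.
  have i10 : (0 < i.-1)%N by lia.
  rewrite /= thetaE; last by lia.
  apply: (@le_trans _ _ ((Q * \sum_(j < nsub pi m k) dx j) `^ p)); last first.
    rewrite powRM// ?sumr_ge0// => [|j _]; last exact: normr_ge0.
    apply: ler_wpM2l; first exact: powR_ge0.
    apply: powR_sum_le; [exact: ltW| by move=> j; exact: normr_ge0|].
    by rewrite -sum1_size sum1_card card_ord nsub_le.
  apply: ge0_ler_powR; rewrite ?nnegrE ?mulr_ge0 ?sumr_ge0//; first by move=> j _; exact: normr_ge0.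
  apply: (le_trans (@schauder_coef_incr _ x _ _ _ (mesh pi m.+1 / c) mc0 _ _)).
  - by rewrite ler_pdivrMr// mulrC mesh_le_block.
  - by rewrite ler_pdivrMr// mulrC mesh_le_block.
  - apply: ler_wpM2l => //.
    apply: (@le_trans _ _ (\sum_(j < i) dx j)).
      have -> : i = i.-1.+1 by lia.
      by rewrite big_ord_recr/= lerD2r; exact: increment_le_sum (leqnn _).
    rewrite (big_ord_widen_cond (nsub pi m k) predT dx)//.
    rewrite [leRHS](bigID (fun j : 'I__ => (j < i)%N))/= lerDl.
    by apply: sumr_ge0 => j _; exact: normr_ge0.
rewrite big_const_nat iter_addr_0 subSS.
have S0 : 0 <= \sum_(j < nsub pi m k) dx j `^ p.
  by apply: sumr_ge0 => j _; exact: powR_ge0.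
set S := \sum_(j < _) _ in S0 *.
have -> : (M%:R * Q) `^ p * S = M%:R * (Q `^ p * (M%:R `^ (p - 1) * S)).
  rewrite powRM ?(ltW M0)//.
  have -> : M%:R `^ p = M%:R `^ (p - 1) * M%:R :> R.
    by rewrite -[X in _ = _ * X](powRr1 (ltW M0)) -powRD ?subrK// (gt_eqF M0) implybT.
  by ring.
rewrite -[leLHS]mulr_natl; apply: ler_wpM2r; first by rewrite !mulr_ge0 ?powR_ge0.
by rewrite ler_nat (leq_trans _ (nsub_le kN))// leq_subr.
Qed.

(** The bound M sqrt(b c) is sharper than the constant of the theorem: as 1 +
    a <= b, the denominator of the latter is at most b^(1 - 1 / p), which
    leaves a power 1 / 2 of b. *)
Lemma forward_const_le p : 1 < p ->
  M%:R * Num.sqrt (b * c) <=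
  (M%:R + 1) ^+ 2 * c `^ (3 / 2) * b `^ (3 / 2 - 1 / p) /
            ((1 + a) `^ (1 - 1 / p) - 1) `^ (1 / p).
Proof.
move=> p1; have p0 : 0 < p by lra.
have a0 := decay_gt0; have ab := decay_le; have c1 := balance_gt1.
have b1 : 1 < b by lra.
have b0 : 0 < b by lra.
have ip : 0 < 1 / p < 1.
  by rewrite div1r invr_gt0 p0 invf_lt1.
set r := 1 - 1 / p; have r0 : 0 < r by rewrite /r; lra.
have A1 : 0 < (1 + a) `^ r - 1.
  have : 1 `^ r < (1 + a) `^ r by apply: gt0_ltr_powR; rewrite ?nnegrE; lra.
  by rewrite powR1 subr_gt0.
have D0 : 0 < ((1 + a) `^ r - 1) `^ (1 / p) by rewrite powR_gt0.
have br1 : 1 <= b `^ r.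
  by rewrite -[leLHS](powRr0 b); apply: ler_powR; lra.
have Db : ((1 + a) `^ r - 1) `^ (1 / p) <= b `^ r.
  apply: (@le_trans _ _ ((b `^ r) `^ (1 / p))).
    apply: ge0_ler_powR; rewrite ?nnegrE ?powR_ge0 ?(ltW A1)//; first by lra.
    rewrite lerBlDr; apply: ler_wpDr => //; apply: ge0_ler_powR; rewrite ?nnegrE; lra.
  rewrite -[leRHS]powRr1 ?powR_ge0//; apply: ler_powR => //; lra.
rewrite ler_pdivlMr//.
apply: (@le_trans _ _ (M%:R * Num.sqrt (b * c) * b `^ r)).
  by apply: ler_wpM2l => //; rewrite mulr_ge0 ?sqrtr_ge0.
have -> : 3 / 2 - 1 / p = 2^-1 + r by rewrite /r; lra.
rewrite [b `^ (2^-1 + r)]powRD ?(gt_eqF b0) ?implybT// powR12_sqrt ?(ltW b0)//.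
rewrite mulrA; apply: ler_wpM2r; first exact: powR_ge0.
rewrite sqrtrM ?(ltW b0)// [Num.sqrt b * _]mulrC mulrA.
apply: ler_wpM2r; first exact: sqrtr_ge0.
apply: ler_pM => //.
  have := ler0n R M; set m := M%:R; nra.
rewrite -powR12_sqrt ?(ltW c0)//; apply: ler_powR; lra.
Qed.

Lemma Theta_p_le (x : R -> R) p v m : 1 < p ->
  (forall n, pvar pi p n x `^ p^-1 <= v) ->
  mesh pi m `^ (1 / 2) * (\sum_(l < cardI pi m) `|Theta pi e x m l| `^ p) `^ p^-1 <=
  (M%:R + 1) ^+ 2 * c `^ (3 / 2) * b `^ (3 / 2 - 1 / p) /
            ((1 + a) `^ (1 - 1 / p) - 1) `^ (1 / p) * v.
Proof.
move=> p1 hv; have p0 : 0 < p by lra.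
have v0 : 0 <= v by apply: le_trans (hv 0%N); exact: powR_ge0.
have m1 := mesh_gt0 T0 hpi m.+1; have m0 := mesh_gt0 T0 hpi m.
have a0 := decay_gt0; have ab := decay_le.
have b0 : 0 < b by lra.
set Q := (Num.sqrt (mesh pi m.+1 / c))^-1.
have Q0 : 0 <= Q by rewrite invr_ge0 sqrtr_ge0.
have MQ0 : 0 <= M%:R * Q by rewrite mulr_ge0.
apply: (@le_trans _ _ (mesh pi m `^ (1 / 2) * (M%:R * Q * v))).
  apply: ler_wpM2l; first exact: powR_ge0.
  apply: (@le_trans _ _ (((M%:R * Q) `^ p * pvar pi p m.+1 x) `^ p^-1)).
    apply: ge0_ler_powR; rewrite ?nnegrE ?invr_ge0 ?(ltW p0)//.
    - by apply: sumr_ge0 => l _; exact: powR_ge0.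
    - by rewrite mulr_ge0 ?powR_ge0// sumr_ge0// => j _; exact: powR_ge0.
    - exact: sum_Theta_powR_le.
  rewrite powRM ?powR_ge0//; last first.
    by rewrite sumr_ge0// => j _; exact: powR_ge0.
  by rewrite -powRrM divff ?gt_eqF// powRr1// ler_wpM2l.
rewrite !mulrA; apply: ler_wpM2r => //.
apply: le_trans (forward_const_le p1).
rewrite -[mesh pi m `^ (1 / 2) * _ * _]mulrA [mesh pi m `^ (1 / 2) * _]mulrC -[leLHS]mulrA.
rewrite [Q * _]mulrC.
apply: ler_wpM2l => //.
rewrite div1r powR12_sqrt ?(ltW m0)// /Q ler_pdivrMr ?sqrtr_gt0 ?divr_gt0//.
rewrite -sqrtrM ?mulr_ge0 ?(ltW b0) ?(ltW c0)//; apply: ler_wsqrtr.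
have -> : b * c * (mesh pi m.+1 / c) = b * mesh pi m.+1 by field; rewrite gt_eqF.
exact: mesh_le_next.
Qed.

End Forward.

(** * Variation of piecewise affine functions under refinement *)
Section Energy.
Context {R : realType} (T : R) (pi : nat -> seq R) (c : R).
Hypothesis T0 : 0 < T.
Hypothesis hpi : refining_partitions T pi.
Hypothesis hbal : balanced pi c.
Variable p : R.
Hypothesis p1 : 1 < p.
Let N n := size (pi n).

(** For g affine on each interval of a partition, this is the integral of
    |g'|^p; this is why it is invariant under refinement. *)
Definition energy n (g : R -> R) : R := \sum_(j < N n)
  `|g (ptime pi n j.+1) - g (ptime pi n j)| `^ p *
  (ptime pi n j.+1 - ptime pi n j) `^ (1 - p).

Lemma pvar_le_energy n g : pvar pi p n g <= mesh pi n `^ (p - 1) * energy n g.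
Proof.
rewrite /pvar /energy mulr_sumr; apply: ler_sum => j _.
have dt := step_gt0 hpi (ltn_ord j); set D := _ - ptime _ _ _ in dt *.
rewrite mulrCA ler_peMr ?powR_ge0//.
rewrite -[1 - p]opprB powRN ler_pdivlMr ?powR_gt0// mul1r.
apply: ge0_ler_powR; rewrite ?nnegrE ?(ltW dt) ?subr_ge0 ?(ltW p1)//.
  exact: ltW (mesh_gt0 T0 hpi n).
exact: (step_le_mesh hpi).
Qed.

Lemma energy_le_pvar n g : energy n g <= (mesh pi n / c) `^ (1 - p) * pvar pi p n g.
Proof.
have c0 := balance_gt0 hbal.
have mc : 0 < mesh pi n / c by rewrite divr_gt0 ?(mesh_gt0 T0 hpi).
rewrite /pvar /energy mulr_sumr; apply: ler_sum => j _.
have dt := step_gt0 hpi (ltn_ord j).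
rewrite mulrC; apply: ler_wpM2r; first exact: powR_ge0.
rewrite -[1 - p]opprB !powRN lef_pV2 ?posrE ?powR_gt0//.
apply: ge0_ler_powR; rewrite ?nnegrE ?(ltW dt) ?(ltW mc) ?subr_ge0 ?(ltW p1)//.
by rewrite ler_pdivrMr// mulrC (mesh_le_step T0 hpi hbal).
Qed.

Lemma affine_energy (k l u v : R) : u < v ->
  `|(k + l * v) - (k + l * u)| `^ p * (v - u) `^ (1 - p) = `|l| `^ p * (v - u).
Proof.
move=> uv; have uv0 : 0 < v - u by rewrite subr_gt0.
have -> : (k + l * v) - (k + l * u) = l * (v - u) by ring.
rewrite normrM (gtr0_norm uv0) powRM ?(ltW uv0)// -mulrA -powRD; last first.
  by rewrite (gt_eqF uv0) implybT.
by rewrite [p + _](_ : _ = 1) ?powRr1 ?(ltW uv0)//; ring.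
Qed.

Lemma energy_refine n g :
  (forall j, (j < N n)%N -> affine_between g (ptime pi n j) (ptime pi n j.+1)) ->
  energy n.+1 g = energy n g.
Proof.
move=> gaff; rewrite /energy (sum_over_blocks T0 hpi (fun j =>
  `|g (ptime pi n.+1 j.+1) - g (ptime pi n.+1 j)| `^ p *
  (ptime pi n.+1 j.+1 - ptime pi n.+1 j) `^ (1 - p))).
apply: eq_bigr => k _; have kN := ltn_ord k.
have [u [l H]] := gaff k kN.
have tk := ptime_lt hpi (ltnSn k) kN.
rewrite (H (ptime pi n k.+1)) ?lexx ?(ltW tk)//.
rewrite (H (ptime pi n k)) ?lexx ?(ltW tk)// affine_energy//.
rewrite -(block_first hpi kN) -(block_last T0 hpi kN).
transitivity (\sum_(i < nsub pi n k) `|l| `^ p * (subnode pi n k i.+1 - subnode pi n k i)).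
  apply: eq_bigr => i _; rewrite -addnS -!/(subnode pi n k _).
  have bi (j : nat) : (j <= nsub pi n k)%N ->
      ptime pi n k <= subnode pi n k j <= ptime pi n k.+1.
    move=> jn; rewrite -(block_first hpi kN) -(block_last T0 hpi kN).
    apply/andP; split; apply: (ptime_le hpi) => //.
    - by rewrite leq_add2l.
    - exact: (block_index_le T0 hpi).
    - by rewrite leq_add2l.
    - exact: (block_index_le T0 hpi).
  rewrite !H ?bi ?(ltnW (ltn_ord i))// affine_energy//.
  exact: (block_lt T0 hpi).
rewrite -mulr_sumr; congr (_ * _).
rewrite -(big_mkord xpredT (fun i => subnode pi n k i.+1 - subnode pi n k i)).
by rewrite telescope_sumr.
Qed.

Lemma affine_refine n g :
  (forall j, (j < N n)%N -> affine_between g (ptime pi n j) (ptime pi n j.+1)) ->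
  (forall j, (j < N n.+1)%N -> affine_between g (ptime pi n.+1 j) (ptime pi n.+1 j.+1)).
Proof.
move=> gaff j /(block_of T0 hpi)[k kN [i iN ->]].
apply: affine_between_sub (gaff k kN).
  rewrite -(block_first hpi kN); apply: (ptime_le hpi) => //; first by rewrite leq_add2l.
  by apply: (block_index_le T0 hpi) => //; exact: ltnW.
rewrite -addnS -(block_last T0 hpi kN); apply: (ptime_le hpi) => //.
  by rewrite leq_add2l.
exact: (block_index_le T0 hpi).
Qed.

Lemma affine_refine_le m n g : (m <= n)%N ->
  (forall j, (j < N m)%N -> affine_between g (ptime pi m j) (ptime pi m j.+1)) ->
  (forall j, (j < N n)%N -> affine_between g (ptime pi n j) (ptime pi n j.+1)) /\
  energy n g = energy m g.
Proof.
move=> /subnK <- gaff; elim: (n - m)%N => [|k [IH1 IH2]]; first by [].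
by rewrite addSn; split; [exact: affine_refine|rewrite energy_refine].
Qed.

(** Compares the p-th variations with the energy on both partitions: on the
    finer one a step is at most the mesh, on the coarser one it is at least
    the mesh divided by c. *)
Lemma pvar_affine_le m n g : (m <= n)%N ->
  (forall j, (j < N m)%N -> affine_between g (ptime pi m j) (ptime pi m j.+1)) ->
  pvar pi p n g <= (c * (mesh pi n / mesh pi m)) `^ (p - 1) * pvar pi p m g.
Proof.
move=> mn gaff; have c0 := balance_gt0 hbal.
have [_ en] := affine_refine_le mn gaff.
have m0 := mesh_gt0 T0 hpi m; have n0 := mesh_gt0 T0 hpi n.
have -> : (c * (mesh pi n / mesh pi m)) `^ (p - 1) =
   mesh pi n `^ (p - 1) * (mesh pi m / c) `^ (1 - p).
  have mc := divr_gt0 m0 c0.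
  have -> : (mesh pi m / c) `^ (1 - p) = (c / mesh pi m) `^ (p - 1).
    by rewrite -[c / _]invf_div -(powR_inv1 (ltW mc)) -powRrM; congr powR; ring.
  rewrite -powRM ?(ltW n0) ?divr_ge0 ?(ltW m0) ?(ltW c0)//; congr powR.
  by field; rewrite gt_eqF.
apply: (le_trans (pvar_le_energy n g)); rewrite -mulrA; apply: ler_wpM2l.
  exact: powR_ge0.
by rewrite en; exact: energy_le_pvar.
Qed.

End Energy.

(** * The level functions of a coefficient matrix *)
Section Levels.
Context {R : realType} (T : R) (pi : nat -> seq R) (M : nat) (c a b : R)
  (e : nat -> seq (nat * nat)).
Hypothesis T0 : 0 < T.
Hypothesis hpi : refining_partitions T pi.
Hypothesis hbal : balanced pi c.
Hypothesis href : complete_refining pi M a b.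
Hypothesis he : schauder_order pi e.
Let N n := size (pi n).

Variable A : nat -> nat -> R.

Definition pair_coef m k i : R := A m (index (k, i) (e m)).

Definition schauder_level m t : R :=
  \sum_(k < N m) schauder_block (subnode pi m k) (nsub pi m k) (pair_coef m k) t.

Definition schauder_partial n t : R := \sum_(m < n) schauder_level m t.

(** The blocks have disjoint supports. *)
Lemma schauder_level_block m k t : (k < N m)%N ->
  ptime pi m k <= t <= ptime pi m k.+1 ->
  schauder_level m t = schauder_block (subnode pi m k) (nsub pi m k) (pair_coef m k) t.
Proof.
move=> kN /andP[kt tk]; rewrite /schauder_level (bigD1 (Ordinal kN))//=.
rewrite big1 ?addr0// => l lk; have lN := ltn_ord l.
rewrite (schauder_block_out _ (fun i j => block_lt T0 hpi lN))//.
rewrite (block_first hpi lN) (block_last T0 hpi lN).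
have {}lk : val l != k by [].
case: (ltngtP l k) => [ltlk|ltkl|/eqP]; last by rewrite (negbTE lk).
  by right; apply: le_trans kt; apply: (ptime_le hpi) => //; exact: ltnW.
by left; apply: (le_trans tk); apply: (ptime_le hpi) => //; exact: ltnW.
Qed.

Lemma schauder_level_out m t : t <= 0 \/ T <= t -> schauder_level m t = 0.
Proof.
move=> H; rewrite /schauder_level big1// => l _; have lN := ltn_ord l.
rewrite (schauder_block_out _ (fun i j => block_lt T0 hpi lN))//.
rewrite (block_first hpi lN) (block_last T0 hpi lN).
have /andP[l0 _] := ptime_itv hpi (ltnW lN).
have /andP[_ lT] := ptime_itv hpi lN.
by case: H => H; [left; apply: le_trans l0|right; apply: le_trans H].
Qed.

Lemma schauder_level_node m j : (j <= N m)%N -> schauder_level m (ptime pi m j) = 0.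
Proof.
move=> jN; rewrite /schauder_level big1// => l _; have lN := ltn_ord l.
rewrite (schauder_block_out _ (fun i j => block_lt T0 hpi lN))//.
rewrite (block_first hpi lN) (block_last T0 hpi lN).
have [jl|lj] := leqP j l; [left|right]; apply: (ptime_le hpi) => //.
exact: ltnW.
Qed.

Lemma schauder_level_node_le n m j : (n <= m)%N -> (j <= N n)%N ->
  schauder_level m (ptime pi n j) = 0.
Proof.
move=> nm jN; have [i] := ptime_next hpi (m - n) jN.
by rewrite subnKC// => iN <-; exact: schauder_level_node.
Qed.

Lemma block_between m k i : (k < N m)%N -> (i <= nsub pi m k)%N ->
  ptime pi m k <= subnode pi m k i <= ptime pi m k.+1.
Proof.
move=> kN iN; rewrite -(block_first hpi kN) -(block_last T0 hpi kN).
apply/andP; split; apply: (ptime_le hpi); rewrite ?leq_add2l//;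
  exact: (block_index_le T0 hpi).
Qed.

Lemma schauder_level_affine m j : (j < N m.+1)%N ->
  affine_between (schauder_level m) (ptime pi m.+1 j) (ptime pi m.+1 j.+1).
Proof.
move=> /(block_of T0 hpi)[k kN [i iN ->]].
have [u [l H]] := schauder_block_affine (pair_coef m k)
  (fun i j => @block_lt _ _ _ T0 hpi m k i j kN) iN.
exists u, l => r ir.
rewrite (schauder_level_block kN); first by apply: H; rewrite /subnode addnS.
have /andP[i1 _] := block_between kN (ltnW iN).
have /andP[_ i2] := block_between kN iN.
move: ir => /andP[ir ri].
by rewrite (le_trans i1 ir)/= (le_trans ri)// -addnS.
Qed.

Lemma theta_schauder_level m k i : (k < N m)%N -> (2 <= i < (nsub pi m k).+1)%N ->
  theta pi (schauder_level m) m k i = pair_coef m k i.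
Proof.
move=> kN iN; rewrite thetaE; last by move: iN; lia.
rewrite -(schauder_block_coef (pair_coef m k)
  (fun i j => @block_lt _ _ _ T0 hpi m k i j kN) iN).
by apply: schauder_coef_eq; apply: (schauder_level_block kN); apply: block_between => //;
  move: iN; lia.
Qed.

(** An earlier level is affine on each interval of pi^m, and a later one
    vanishes at all points of pi^(m+1). *)
Lemma theta_schauder_level_neq m m' k i : m' != m -> (k < N m)%N ->
  (2 <= i < (nsub pi m k).+1)%N -> theta pi (schauder_level m') m k i = 0.
Proof.
move=> mm kN iN; rewrite thetaE; last by move: iN; lia.
have lt12 : subnode pi m k 0 < subnode pi m k i.-1 by apply: (block_lt T0 hpi) => //; move: iN; lia.
have lt23 : subnode pi m k i.-1 < subnode pi m k i by apply: (block_lt T0 hpi) => //; move: iN; lia.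
case: (ltngtP m' m) => [m'm|mm'|/eqP]; last by rewrite (negbTE mm).
  apply: schauder_coef_affine; rewrite ?(ltW lt12) ?(ltW lt23)//.
  have [+ _] := affine_refine_le T0 hpi 2 m'm (@schauder_level_affine m').
  move=> /(_ k kN); apply: affine_between_sub.
    by rewrite (block_first hpi kN).
  have iN2 : (i <= nsub pi m k)%N by move: iN; lia.
  by case/andP: (block_between kN iN2).
rewrite -(schauder_coef_affine (x := fun=> 0) (ltW lt12) (ltW lt23)); last first.
  by exists 0, 0 => r _; rewrite mul0r addr0.
by apply: schauder_coef_eq; rewrite /subnode schauder_level_node_le//;
  apply: (block_index_le T0 hpi) => //; move: iN; lia.
Qed.

Lemma theta_sum n (F : nat -> R -> R) m k i :
  theta pi (fun t => \sum_(l < n) F l t) m k i = \sum_(l < n) theta pi (F l) m k i.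
Proof.
rewrite /theta -!sumrB !mulr_suml -sumrB mulr_suml.
by apply: eq_bigr => l _; ring.
Qed.

Lemma theta_schauder_partial n m k i : (m < n)%N -> (k < N m)%N ->
  (2 <= i < (nsub pi m k).+1)%N -> theta pi (schauder_partial n) m k i = pair_coef m k i.
Proof.
move=> mn kN iN; rewrite /schauder_partial theta_sum.
rewrite (bigD1 (Ordinal mn))//= theta_schauder_level// big1 ?addr0// => l lm.
exact: theta_schauder_level_neq.
Qed.

Lemma uniq_order m : uniq (e m).
Proof.
rewrite (perm_uniq (he m)); apply: allpairs_uniq_dep; rewrite ?iota_uniq//.
  by move=> k _; exact: iota_uniq.
by move=> [k i] [k' i'] _ _ [-> ->].
Qed.

Lemma pair_coef_nth m l : (l < cardI pi m)%N ->
  pair_coef m (nth (0, 0)%N (e m) l).1 (nth (0, 0)%N (e m) l).2 = A m l.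
Proof.
move=> lI; rewrite /pair_coef -surjective_pairing index_uniq ?uniq_order//.
by rewrite (size_order T0 hpi he).
Qed.

Lemma sum_pair_coef p m :
  \sum_(k < N m) \sum_(2 <= i < (nsub pi m k).+1) `|pair_coef m k i| `^ p =
  \sum_(l < cardI pi m) `|A m l| `^ p.
Proof.
rewrite -(sum_order T0 hpi he (fun ki => `|pair_coef m ki.1 ki.2| `^ p)).
by apply: eq_bigr => l _; rewrite pair_coef_nth.
Qed.

Section SupNorm.
Variables (al s : R).
Hypothesis al01 : 0 < al < 1.
Hypothesis s0 : 0 < s.
Hypothesis hs : forall m l, mesh pi m.+1 `^ (1 / 2 - al) * `|A m l| <= s.

Let d m := mesh pi m.+1.
Let d0 m : 0 < d m. Proof. exact: (mesh_gt0 T0 hpi). Qed.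

Lemma pair_coef_le m k i : `|pair_coef m k i| <= s * d m `^ al / Num.sqrt (d m).
Proof.
have := hs m (index (k, i) (e m)); rewrite -/(pair_coef m k i) -/(d m).
have sd : 0 < Num.sqrt (d m) by rewrite sqrtr_gt0.
have da : 0 < d m `^ al by rewrite powR_gt0.
rewrite powRB; last by rewrite (gt_eqF (d0 m)) implybT.
rewrite div1r powR12_sqrt ?(ltW (d0 m))// => H.
by rewrite ler_pdivlMr// -ler_pdivrMr//; apply: le_trans H; rewrite -mulrA mulrC.
Qed.

Let be m := s * d m `^ al / Num.sqrt (d m).
Let be0 m : 0 <= be m.
Proof. by rewrite !mulr_ge0 ?invr_ge0 ?powR_ge0 ?sqrtr_ge0 ?(ltW s0). Qed.

Lemma schauder_level_sup m t : `|schauder_level m t| <= M%:R / 2 * s * d m `^ al.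
Proof.
have rhs0 : 0 <= M%:R / 2 * s * d m `^ al by rewrite !mulr_ge0 ?powR_ge0 ?(ltW s0).
have [t0|t0] := leP t 0; first by rewrite schauder_level_out ?normr0//; left.
have [tT|tT] := leP T t; first by rewrite schauder_level_out ?normr0//; right.
have [|k kN kt] := ptime_step T0 hpi m (t := t); first by rewrite !ltW.
rewrite (schauder_level_block kN kt).
apply: (le_trans (schauder_block_sup (fun i j => @block_lt _ _ _ T0 hpi m k i j kN)
  (d0 m) _ (fun i _ => pair_coef_le m k i) t (be0 m))).
  by move=> j jn; exact: (block_step_le T0 hpi).
have -> : (nsub pi m k)%:R / 2 * Num.sqrt (d m) * (s * d m `^ al / Num.sqrt (d m)) =
  (nsub pi m k)%:R * (2^-1 * s * d m `^ al).
  by field; rewrite gt_eqF ?sqrtr_gt0.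
rewrite -!mulrA; apply: ler_wpM2r; last by rewrite ler_nat (nsub_le href kN).
by rewrite !mulr_ge0 ?powR_ge0 ?(ltW s0).
Qed.

(** Within a block this is the Lipschitz bound on a sum of at most M
    triangles. For points of different blocks, the function vanishes at the
    ends of the blocks, so the path between the two points may be cut there. *)
Lemma schauder_level_lip m t t' : 0 <= t <= T -> 0 <= t' <= T ->
  `|schauder_level m t - schauder_level m t'| <=
    M%:R * Num.sqrt c * s * d m `^ (al - 1) * `|t - t'|.
Proof.
wlog tt : t t' / t <= t'.
  move=> H tT tT'; have [?|?] := leP t t'; first exact: H.
  by rewrite distrC [`|t - t'|]distrC; apply: H => //; exact: ltW.
move=> tT tT'; set C := M%:R * _ * _ * _.
have c0 := balance_gt0 hbal.
have C0 : 0 <= C by rewrite !mulr_ge0 ?powR_ge0 ?sqrtr_ge0 ?(ltW s0).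
have inblock k u v : (k < N m)%N ->
    ptime pi m k <= u <= ptime pi m k.+1 -> ptime pi m k <= v <= ptime pi m k.+1 ->
    `|schauder_level m u - schauder_level m v| <= C * `|u - v|.
  move=> kN uk vk; rewrite !(schauder_level_block kN)//.
  apply: (le_trans (schauder_block_lip (fun i j => @block_lt _ _ _ T0 hpi m k i j kN)
    (L := Num.sqrt (c / d m)) u v (fun i _ => pair_coef_le m k i) _ (be0 m) _)).
  - exact: sqrtr_ge0.
  - move=> j jn; rewrite sqr_sqrtr ?divr_ge0 ?(ltW c0) ?(ltW (d0 m))//.
    rewrite -[leRHS]invf_div lef_pV2 ?posrE ?divr_gt0// ?subr_gt0; last first.
      exact: (block_lt T0 hpi kN).
    by rewrite ler_pdivrMr// mulrC (mesh_le_block_step T0 hpi hbal).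
  - apply: ler_wpM2r => //.
    have dE : d m = Num.sqrt (d m) * Num.sqrt (d m).
      by rewrite -expr2 sqr_sqrtr// ltW.
    rewrite /C; have -> : d m `^ (al - 1) = d m `^ al / (Num.sqrt (d m) * Num.sqrt (d m)).
      rewrite powRB; last by rewrite (gt_eqF (d0 m)) implybT.
      by rewrite powRr1 ?(ltW (d0 m))// -dE.
    rewrite sqrtrM ?(ltW c0)// sqrtrV ?(ltW (d0 m))//.
    have sd : Num.sqrt (d m) != 0 by rewrite gt_eqF ?sqrtr_gt0.
    have -> : (nsub pi m k)%:R * (s * d m `^ al / Num.sqrt (d m)) *
       (Num.sqrt c / Num.sqrt (d m)) = (nsub pi m k)%:R *
       (Num.sqrt c * s * (d m `^ al / (Num.sqrt (d m) * Num.sqrt (d m)))) by field.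
    rewrite -!mulrA; apply: ler_wpM2r; last by rewrite ler_nat (nsub_le href kN).
    by rewrite !mulr_ge0 ?invr_ge0 ?powR_ge0 ?sqrtr_ge0 ?(ltW s0).
have [k kN kt] := ptime_step T0 hpi m tT.
have [k' kN' kt'] := ptime_step T0 hpi m tT'.
have [tk'|k't] := leP t' (ptime pi m k.+1).
  by apply: (inblock k) => //; rewrite tk' (le_trans _ tt)//; case/andP: kt.
have [tk|kt2] := leP (ptime pi m k') t.
  by apply: (inblock k') => //; rewrite tk (le_trans tt)//; case/andP: kt'.
have kk' : ptime pi m k.+1 <= ptime pi m k'.
  apply: (ptime_le hpi) => //; last exact: ltnW.
  rewrite ltnNge; apply/negP => k'k.
  have : t' <= ptime pi m k.+1.
    by case/andP: kt' => _ /le_trans; apply; apply: (ptime_le hpi).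
  by rewrite leNgt k't.
have n1 : schauder_level m (ptime pi m k.+1) = 0 by exact: schauder_level_node.
have n2 : schauder_level m (ptime pi m k') = 0 by apply: schauder_level_node; exact: ltnW.
(* Cut the path at the right end of the first block and at the left end of
   the last one, where the level function vanishes. *)
have tk1 := ptime_lt hpi (ltnSn k) kN.
have tk2 := ptime_lt hpi (ltnSn k') kN'.
have := inblock k t (ptime pi m k.+1) kN kt; rewrite lexx (ltW tk1) => /(_ isT).
have := inblock k' t' (ptime pi m k') kN' kt'; rewrite lexx (ltW tk2) => /(_ isT).
rewrite n1 n2 !subr0 => H2 H1; apply: (le_trans (ler_normB _ _)).
apply: (le_trans (lerD H1 H2)); rewrite -mulrDr; apply: ler_wpM2l => //.
move: kt kt' => /andP[_ q1] /andP[q2 _].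
have e1 : `|t - ptime pi m k.+1| = ptime pi m k.+1 - t by rewrite ler0_norm ?opprB// subr_le0.
have e2 : `|t' - ptime pi m k'| = t' - ptime pi m k' by rewrite ger0_norm// subr_ge0.
have e3 : `|t - t'| = t' - t by rewrite ler0_norm ?opprB// subr_le0.
by rewrite e1 e2 e3; lra.
Qed.

Let K1 := 1 / (1 - (1 + a) `^ (al - 1)).
Let K2 := 1 / (1 - (1 + a) `^ (- al)).
Let a0 : 0 < a := decay_gt0 href.
Let dS m : (1 + a) * d m.+1 <= d m. Proof. exact: (mesh_decay T0 hpi href). Qed.

Lemma schauder_partial_abs n t :
  \sum_(m < n) `|schauder_level m t| <= M%:R / 2 * s * K2 * mesh pi 1 `^ al.
Proof.
have /andP[al0 _] := al01.
apply: (@le_trans _ _ (\sum_(m < n) M%:R / 2 * s * d m `^ al)).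
  by apply: ler_sum => m _; exact: schauder_level_sup.
rewrite -mulr_sumr -!mulrA ler_wpM2l// ler_wpM2l ?invr_ge0// ler_wpM2l ?(ltW s0)//.
rewrite mul1r; exact: (sum_powR_first a0 n al0 d0 dS).
Qed.

(** Low levels, with mesh at least |t - t'|, are estimated by their Lipschitz
    constants and high levels by twice their supremum; each of the two sums is
    geometric. *)
Lemma schauder_partial_Holder n t t' : 0 <= t <= T -> 0 <= t' <= T ->
  `|schauder_partial n t - schauder_partial n t'| <=
    s * (M%:R * Num.sqrt c * K1 + M%:R * K2) * `|t - t'| `^ al.
Proof.
move=> tT tT'; have /andP[al0 al1] := al01.
have [->|neq] := eqVneq t t'; first by rewrite !subrr normr0 powR0 ?mulr0// gt_eqF.
set h := `|t - t'|; have h0 : 0 < h by rewrite normr_gt0 subr_eq0.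
rewrite /schauder_partial -sumrB; apply: (le_trans (ler_norm_sum _ _ _)).
rewrite (bigID (fun m : 'I_n => h <= d m))/= mulrDr mulrDl.
apply: lerD.
  apply: (@le_trans _ _ (\sum_(m < n | h <= d m) M%:R * Num.sqrt c * s * h * d m `^ (al - 1))).
    by apply: ler_sum => m _; rewrite mulrAC; exact: schauder_level_lip.
  rewrite -mulr_sumr.
  have -> : s * (M%:R * Num.sqrt c * K1) * h `^ al =
    M%:R * Num.sqrt c * s * h * (K1 * h `^ (al - 1)).
    have -> : h `^ al = h * h `^ (al - 1).
      rewrite -{2}(powRr1 (ltW h0)) -powRD ?(gt_eqF h0) ?implybT//.
      by congr powR; ring.
    by ring.
  apply: ler_wpM2l; first by rewrite !mulr_ge0 ?sqrtr_ge0 ?(ltW s0) ?(ltW h0).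
  rewrite /K1 div1r; apply: (sum_powR_above a0 d0 dS) => //.
  by rewrite subr_lt0.
apply: (@le_trans _ _ (\sum_(m < n | d m < h) M%:R * s * d m `^ al)).
  under [leRHS]eq_bigl do rewrite ltNge.
  apply: ler_sum => m _; apply: (le_trans (ler_normB _ _)).
  apply: (le_trans (lerD (schauder_level_sup m t) (schauder_level_sup m t'))).
  by lra.
rewrite -mulr_sumr.
have -> : s * (M%:R * K2) * h `^ al = M%:R * s * (K2 * h `^ al) by ring.
apply: ler_wpM2l; first by rewrite mulr_ge0 ?(ltW s0).
rewrite /K2 div1r; exact: (sum_powR_below a0 n al0 h0 d0 dS).
Qed.

End SupNorm.

Section PNorm.
Variables (p q : R).
Hypothesis p1 : 1 < p.
Hypothesis q0 : 0 < q.
Hypothesis hq : forall m, mesh pi m `^ (1 / 2) *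
  (\sum_(l < cardI pi m) `|A m l| `^ p) `^ p^-1 <= q.

Let p0 : 0 < p. Proof. exact: lt_trans p1. Qed.
Let d m := mesh pi m.+1.
Let d0 m : 0 < d m. Proof. exact: (mesh_gt0 T0 hpi). Qed.
Let a0 : 0 < a := decay_gt0 href.

Lemma sum_coef_powR_le m :
  \sum_(l < cardI pi m) `|A m l| `^ p <= (q / Num.sqrt (mesh pi m)) `^ p.
Proof.
have m0 := mesh_gt0 T0 hpi m; have sm : 0 < Num.sqrt (mesh pi m) by rewrite sqrtr_gt0.
have := hq m; set S := \sum_(l < _) _.
have S0 : 0 <= S by apply: sumr_ge0 => l _; exact: powR_ge0.
rewrite div1r powR12_sqrt ?(ltW m0)// mulrC -ler_pdivlMr// => H.
rewrite -[leLHS]powRr1// -(mulVf (lt0r_neq0 p0)) powRrM.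
apply: ge0_ler_powR; rewrite ?nnegrE ?powR_ge0 ?divr_ge0 ?(ltW p0) ?(ltW q0)//.
Qed.

(** An increment over a step is at most sqrt(d m) times the sum of the
    absolute coefficients of its block, and each of these sums occurs at most
    M times. *)
Lemma pvar_schauder_level m : pvar pi p m.+1 (schauder_level m) <=
  (M%:R * (q * Num.sqrt (d m / mesh pi m))) `^ p.
Proof.
have m0 := mesh_gt0 T0 hpi m; have sm : 0 < Num.sqrt (mesh pi m) by rewrite sqrtr_gt0.
have sd : 0 < Num.sqrt (d m) by rewrite sqrtr_gt0.
have M0 : 0 < M%:R :> R by rewrite ltr0n (refinement_gt0 href).
have -> : (M%:R * (q * Num.sqrt (d m / mesh pi m))) `^ p =
    (M%:R * Num.sqrt (d m)) `^ p * (q / Num.sqrt (mesh pi m)) `^ p.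
  rewrite -powRM ?mulr_ge0 ?invr_ge0 ?(ltW q0) ?(ltW sm) ?(ltW sd)//; congr powR.
  by rewrite sqrtrM ?(ltW (d0 m))// sqrtrV ?(ltW m0)//; field; rewrite gt_eqF.
apply: le_trans (ler_wpM2l (powR_ge0 _ _) (sum_coef_powR_le m)).
rewrite (pvar_blocks T0 hpi) -sum_pair_coef mulr_sumr.
apply: ler_sum => k _; have kN := ltn_ord k.
set S := \sum_(2 <= i < _) _.
have S0 : 0 <= S by apply: sumr_ge0 => i _; exact: powR_ge0.
apply: (@le_trans _ _ (\sum_(i < nsub pi m k) (Num.sqrt (d m) `^ p * (M%:R `^ (p - 1) * S)))).
  apply: ler_sum => i _.
  rewrite !(schauder_level_block kN); first last.
  - exact: block_between.
  - by apply: block_between => //; exact: ltnW.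
  apply: (@le_trans _ _ ((Num.sqrt (d m) *
     \sum_(2 <= i < (nsub pi m k).+1) `|pair_coef m k i|) `^ p)).
    apply: ge0_ler_powR; rewrite ?nnegrE ?mulr_ge0 ?(ltW p0) ?(ltW sd)//.
      by apply: sumr_ge0 => j _; exact: normr_ge0.
    apply: schauder_block_incr; [|exact: d0|].
      by move=> ? ?; exact: (block_lt T0 hpi kN).
    by move=> j jn; exact: (block_step_le T0 hpi).
  rewrite powRM ?(ltW sd)//; last by apply: sumr_ge0 => j _; exact: normr_ge0.
  apply: ler_wpM2l; first exact: powR_ge0.
  apply: powR_sum_le; [exact: ltW|by move=> j; exact: normr_ge0|].
  by rewrite size_iota subSS (leq_trans (leq_subr _ _))// (nsub_le href kN).
rewrite sumr_const card_ord -[leLHS]mulr_natl.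
have -> : (M%:R * Num.sqrt (d m)) `^ p * S =
   M%:R * (Num.sqrt (d m) `^ p * (M%:R `^ (p - 1) * S)).
  rewrite powRM ?(ltW M0) ?(ltW sd)//.
  have -> : M%:R `^ p = M%:R `^ (p - 1) * M%:R :> R.
    by rewrite -[X in _ = _ * X](powRr1 (ltW M0)) -powRD ?subrK// (gt_eqF M0) implybT.
  by ring.
apply: ler_wpM2r; first by rewrite !mulr_ge0 ?powR_ge0.
by rewrite ler_nat (nsub_le href kN).
Qed.

Let r := 1 - 1 / p.
Let G n := c `^ r * (M%:R * (q / Num.sqrt (1 + a))) * mesh pi n `^ r.

Lemma pvar_schauder_level_le m n : (m < n)%N ->
  pvar pi p n (schauder_level m) <= (G n * d m `^ (- r)) `^ p.
Proof.
move=> mn; have c0 := balance_gt0 hbal.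
have n0 := mesh_gt0 T0 hpi n; have m0 := mesh_gt0 T0 hpi m.
have a1 : 0 < 1 + a by rewrite addr_gt0.
have M0 : 0 < M%:R :> R by rewrite ltr0n (refinement_gt0 href).
have sa : 0 < Num.sqrt (1 + a) by rewrite sqrtr_gt0.
apply: (le_trans (pvar_affine_le T0 hpi hbal p1 mn (@schauder_level_affine m))).
have -> : (G n * d m `^ (- r)) `^ p =
   (c * (mesh pi n / d m)) `^ (p - 1) * (M%:R * (q / Num.sqrt (1 + a))) `^ p.
  have -> : (p - 1) = r * p by rewrite /r; field; rewrite gt_eqF.
  rewrite powRrM -powRM ?powR_ge0 ?mulr_ge0 ?invr_ge0 ?(ltW q0) ?(ltW sa)//.
  congr powR; rewrite /G powRN.
  rewrite [(c * _) `^ r]powRM ?divr_ge0 ?(ltW c0) ?(ltW n0) ?(ltW (d0 m))//.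
  rewrite [(mesh pi n / _) `^ r]powRM ?invr_ge0 ?(ltW n0) ?(ltW (d0 m))//.
  rewrite -[X in _ = _ * (_ * X `^ r) * _](powR_inv1 (ltW (d0 m))) -powRrM mulN1r powRN.
  by ring.
apply: ler_wpM2l; first exact: powR_ge0.
apply: (le_trans (pvar_schauder_level m)).
apply: ge0_ler_powR; rewrite ?nnegrE ?mulr_ge0 ?invr_ge0 ?sqrtr_ge0 ?(ltW p0) ?(ltW q0)//.
apply: ler_wpM2l; rewrite ?(ltW M0)//; apply: ler_wpM2l; rewrite ?(ltW q0)//.
rewrite -sqrtrV ?(ltW a1)//; apply: ler_wsqrtr.
rewrite ler_pdivrMr// mulrC ler_pdivlMr// mulrC; exact: (mesh_decay T0 hpi href).
Qed.

(** The factor (1 + a)^(1 - 1 / p) that comes from normalising the geometric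
    series is absorbed, after division by sqrt(1 + a), by sqrt b, as 1 + a <=
    b. *)
Lemma backward_const_le :
  c `^ r * (M%:R / Num.sqrt (1 + a)) * (1 - (1 + a) `^ (- r))^-1 <=
  c `^ (1 / p) * (M%:R * c * Num.sqrt (b * M%:R)) / ((1 + a) `^ (1 - 1 / p) - 1).
Proof.
have c1 := balance_gt1 hbal; have c0 := balance_gt0 hbal.
have ab := decay_le href; have a0' := a0; have p1' := p1.
have M0 : 0 < M%:R :> R by rewrite ltr0n (refinement_gt0 href).
have M1 : 1 <= M%:R :> R by rewrite ler1n (refinement_gt0 href).
have a1 : 0 < 1 + a by lra.
have b0 : 0 < b by lra.
have ip : 0 < 1 / p < 1 by rewrite div1r invr_gt0 p0 invf_lt1.
have r0 : 0 < r by rewrite /r; lra.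
have r1 : r < 1 by rewrite /r; lra.
have A1 : 0 < (1 + a) `^ r - 1.
  have : 1 `^ r < (1 + a) `^ r by apply: gt0_ltr_powR; rewrite ?nnegrE; lra.
  by rewrite powR1 subr_gt0.
have P0 : 0 < (1 + a) `^ r by rewrite powR_gt0.
have sa : 0 < Num.sqrt (1 + a) by rewrite sqrtr_gt0.
rewrite -/r powRN.
have -> : c `^ r * (M%:R / Num.sqrt (1 + a)) / (1 - ((1 + a) `^ r)^-1) =
  c `^ r * (M%:R * ((1 + a) `^ r / Num.sqrt (1 + a))) / ((1 + a) `^ r - 1).
  by field; rewrite !gt_eqF.
apply: ler_wpM2r; first by rewrite invr_ge0 ltW.
have -> : c `^ (1 / p) * (M%:R * c * Num.sqrt (b * M%:R)) =
   (c `^ (1 / p) * c) * (M%:R * Num.sqrt (b * M%:R)) by ring.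
apply: ler_pM; rewrite ?powR_ge0 ?mulr_ge0 ?invr_ge0 ?powR_ge0 ?(ltW sa) ?(ltW M0)//.
  rewrite -[X in _ * X](powRr1 (ltW c0)) -powRD ?(gt_eqF c0) ?implybT//.
  by apply: ler_powR; lra.
apply: ler_wpM2l; rewrite ?(ltW M0)//.
rewrite ler_pdivrMr//.
apply: (@le_trans _ _ (1 + a)).
  by rewrite -[leRHS]powRr1 ?(ltW a1)//; apply: ler_powR; lra.
have {1}-> : 1 + a = Num.sqrt (1 + a) * Num.sqrt (1 + a).
  by rewrite -expr2 sqr_sqrtr ?(ltW a1).
rewrite ler_wpM2r ?(ltW sa)//; apply: ler_wsqrtr.
by apply: (le_trans ab); rewrite ler_peMr ?(ltW b0).
Qed.

(** The bounds on the variations of the levels m < n form a geometric series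
    in d m ^ (- r), dominated by its last term, whose index is n - 1; this
    term cancels the factor mesh pi n ^ r. *)
Lemma pvar_schauder_partial n : pvar pi p n (schauder_partial n) `^ p^-1 <=
  c `^ (1 / p) * (M%:R * c * Num.sqrt (b * M%:R)) / ((1 + a) `^ (1 - 1 / p) - 1) * q.
Proof.
have c0 := balance_gt0 hbal.
have n0 := mesh_gt0 T0 hpi n.
have a1 : 0 < 1 + a by rewrite addr_gt0.
have M0 : 0 < M%:R :> R by rewrite ltr0n (refinement_gt0 href).
have sa : 0 < Num.sqrt (1 + a) by rewrite sqrtr_gt0.
have r0 : 0 < r.
  have p1' := p1; have : p^-1 < 1 by rewrite invf_lt1.
  by rewrite /r; lra.
have G0 m : 0 < G n * d m `^ (- r).
  by rewrite /G !mulr_gt0 ?invr_gt0 ?powR_gt0.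
have K0 := @geometric_const_gt0 _ _ a0 (- r) ltac:(lra).
apply: (@le_trans _ _ (\sum_(m < n) (G n * d m `^ (- r)))).
  set C := \sum_(m < n) _.
  have C0 : 0 <= C by apply: sumr_ge0 => m _; exact: ltW.
  have -> : C = (C `^ p) `^ p^-1 by rewrite -powRrM divff ?gt_eqF// powRr1.
  apply: ge0_ler_powR; rewrite ?nnegrE ?invr_ge0 ?powR_ge0 ?(ltW p0)//.
    by apply: sumr_ge0 => j _; exact: powR_ge0.
  rewrite /pvar; under eq_bigr do rewrite /schauder_partial -sumrB.
  apply: (minkowski_sum (f := fun m (j : 'I__) => schauder_level m (ptime pi n j.+1) -
     schauder_level m (ptime pi n j)) (ltW p1) G0) => m mn.
  exact: pvar_schauder_level_le.
apply: (@le_trans _ _ (c `^ r * (M%:R / Num.sqrt (1 + a)) * (1 - (1 + a) `^ (- r))^-1 * q));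
  last first.
  by apply: ler_wpM2r; rewrite ?(ltW q0)//; exact: backward_const_le.
case: n n0 {G0} => [|n] n0.
  by rewrite big_ord0 !mulr_ge0 ?invr_ge0 ?powR_ge0 ?(ltW K0) ?(ltW sa) ?(ltW q0).
rewrite -mulr_sumr /G.
apply: (@le_trans _ _ (c `^ r * (M%:R * (q / Num.sqrt (1 + a))) * mesh pi n.+1 `^ r *
  ((1 - (1 + a) `^ (- r))^-1 * d n `^ (- r)))).
  apply: ler_wpM2l; first by rewrite !mulr_ge0 ?invr_ge0 ?powR_ge0 ?(ltW sa) ?(ltW q0).
  apply: (sum_powR_last a0 d0) => //; last by lra.
  by move=> m; exact: (mesh_decay T0 hpi href).
rewrite (powRN (d n)) -/(d n) le_eqVlt; apply/orP; left; apply/eqP.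
have dn : 0 < d n `^ r by rewrite powR_gt0.
by field; rewrite !gt_eqF.
Qed.

End PNorm.

End Levels.

(** * The function with a given coefficient matrix *)
Section Limits.
Context {R : realType}.

Lemma Holder_C0 (T : R) (x : R -> R) al C : 0 < al ->
  (forall s t, 0 <= s <= T -> 0 <= t <= T -> `|x s - x t| <= C * `|s - t| `^ al) ->
  (forall t, t \notin `[0, T] -> x t = 0) -> C0 T x.
Proof.
move=> al0 H xout; split=> //; apply/subspace_continuousP => t /=.
rewrite in_itv/= => tT; apply/cvgrPdist_lt => r r0.
have C1 : 0 < `|C| + 1 by rewrite ltr_wpDl.
have rC : 0 < r / (`|C| + 1) by rewrite divr_gt0.
rewrite near_withinE; apply/nbhs_ballP; exists ((r / (`|C| + 1)) `^ al^-1) => /=.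
  exact: powR_gt0.
move=> u; rewrite /ball/= => tu; rewrite in_itv/= => uT.
rewrite /from_subspace; apply: (le_lt_trans (H _ _ tT uT)).
apply: (@le_lt_trans _ _ ((`|C| + 1) * `|t - u| `^ al)).
  by apply: ler_wpM2r; rewrite ?powR_ge0// (le_trans (ler_norm C))// lerDl.
rewrite mulrC -ltr_pdivlMr//.
have -> : r / (`|C| + 1) = ((r / (`|C| + 1)) `^ al^-1) `^ al.
  by rewrite -powRrM mulVf ?gt_eqF// powRr1// ltW.
by apply: gt0_ltr_powR; rewrite ?nnegrE ?powR_ge0.
Qed.

Lemma norm_lim_le (u : nat -> R) (l C : R) :
  u n @[n --> \oo] --> l -> (forall n, `|u n| <= C) -> `|l| <= C.
Proof.
move=> ul uC; have nl : `|u n| @[n --> \oo] --> `|l| by exact: cvg_norm.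
rewrite -(cvg_lim _ nl)//; apply: limr_le; first by apply/cvg_ex; exists `|l|.
by apply: nearW => n; exact: uC.
Qed.

End Limits.

Section Series.
Context {R : realType} (T : R) (pi : nat -> seq R) (M : nat) (c a b : R)
  (e : nat -> seq (nat * nat)).
Hypothesis T0 : 0 < T.
Hypothesis hpi : refining_partitions T pi.
Hypothesis hbal : balanced pi c.
Hypothesis href : complete_refining pi M a b.
Hypothesis he : schauder_order pi e.
Let N n := size (pi n).

Variable A : nat -> nat -> R.
(** The pointwise limit suffices: the Hoelder bound is uniform in n and passes
    to the limit, and it implies continuity. *)
Definition schauder_series t : R := limn (fun n => schauder_partial pi e A n t).

(** At a point of pi^n the series is a finite sum, since all levels from n on
    vanish there. *)
Lemma schauder_series_node n j : (j <= N n)%N ->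
  schauder_series (ptime pi n j) = schauder_partial pi e A n (ptime pi n j).
Proof.
move=> jN; apply: norm_lim_near_cst; exists n => // k /= nk.
rewrite -(subnKC nk) /schauder_partial big_split_ord/= [X in _ + X]big1 ?addr0// => i _.
exact: (schauder_level_node_le e T0 hpi A (leq_addr _ _) jN).
Qed.

Lemma schauder_series_out t : t <= 0 \/ T <= t -> schauder_series t = 0.
Proof.
move=> H; apply: norm_lim_near_cst; apply: nearW => n.
by rewrite /schauder_partial big1// => m _; exact: (schauder_level_out e T0 hpi A).
Qed.

Lemma schauder_series_ends : vanish_at_ends T schauder_series.
Proof. by split; apply: schauder_series_out; [left|right]. Qed.

Lemma Theta_schauder_series : Mpi pi A -> Theta pi e schauder_series = A.
Proof.
move=> MA; apply/funext => m; apply/funext => l.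
have [lI|lI] := ltnP l (cardI pi m); last by rewrite MA// (Theta_Mpi e _ lI).
rewrite ThetaE// -[RHS](pair_coef_nth T0 hpi he A lI).
have [k [i [-> kN iN]]] := nth_orderP T0 hpi he lI.
rewrite /= -(theta_schauder_partial e T0 hpi A (ltnSn m) kN iN).
rewrite !thetaE; try by move: iN; lia.
by apply: schauder_coef_eq; apply: schauder_series_node;
  apply: (block_index_le T0 hpi kN); move: iN; lia.
Qed.

Lemma pvar_schauder_series p q n : 1 < p -> 0 < q ->
  (forall m, mesh pi m `^ (1 / 2) *
    (\sum_(l < cardI pi m) `|A m l| `^ p) `^ p^-1 <= q) ->
  pvar pi p n schauder_series `^ p^-1 <=
  c `^ (1 / p) * (M%:R * c * Num.sqrt (b * M%:R)) / ((1 + a) `^ (1 - 1 / p) - 1) * q.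
Proof.
move=> p1 q0 hq.
apply: le_trans (pvar_schauder_partial T0 hpi hbal href he p1 q0 hq n).
rewrite le_eqVlt; apply/orP; left; apply/eqP; congr powR.
apply: eq_bigr => j _.
by rewrite !schauder_series_node// ltnW// ltn_ord.
Qed.

Variables (al s : R).
Hypothesis al01 : 0 < al < 1.
Hypothesis s0 : 0 < s.
Hypothesis hs : forall m l, mesh pi m.+1 `^ (1 / 2 - al) * `|A m l| <= s.
Lemma schauder_partial_cvg t :
  schauder_partial pi e A n t @[n --> \oo] --> schauder_series t.
Proof.
suff H : cvgn (series (fun m => schauder_level pi e A m t)).
  suff E : (fun n => schauder_partial pi e A n t) =
    series (fun m => schauder_level pi e A m t) by rewrite /schauder_series E.
  by apply/funext => n; rewrite /series/= big_mkord.
apply: normed_cvg; apply: nondecreasing_is_cvgn.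
  by apply: nondecreasing_series => n _ _; exact: normr_ge0.
exists (M%:R / 2 * s * (1 / (1 - (1 + a) `^ (- al))) * mesh pi 1 `^ al).
move=> _ [n _ <-]; rewrite /= seriesEord/=.
exact: (schauder_partial_abs e T0 hpi href al01 s0 hs).
Qed.

Lemma schauder_series_sup t : `|schauder_series t| <=
  M%:R / 2 * s * (1 / (1 - (1 + a) `^ (- al))) * mesh pi 1 `^ al.
Proof.
apply: (norm_lim_le (@schauder_partial_cvg t)) => n.
apply: le_trans (schauder_partial_abs e T0 hpi href al01 s0 hs n t).
exact: ler_norm_sum.
Qed.

Lemma schauder_series_Holder t t' : 0 <= t <= T -> 0 <= t' <= T ->
  `|schauder_series t - schauder_series t'| <=
    s * (M%:R * Num.sqrt c * (1 / (1 - (1 + a) `^ (al - 1))) +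
         M%:R * (1 / (1 - (1 + a) `^ (- al)))) * `|t - t'| `^ al.
Proof.
move=> tT tT'.
apply: (norm_lim_le (cvgB (@schauder_partial_cvg t) (@schauder_partial_cvg t'))) => n.
exact: (schauder_partial_Holder e T0 hpi hbal href al01 s0 hs).
Qed.

Lemma schauder_series_C0 : C0 T schauder_series.
Proof.
have /andP[al0 _] := al01.
apply: (Holder_C0 al0 schauder_series_Holder) => t; rewrite in_itv/= => tT.
apply: schauder_series_out; have [|t0] := leP t 0; [by left|right].
by apply: ltW; move: tT; rewrite (ltW t0)/= -ltNge.
Qed.

End Series.

(** * The isomorphism *)
Section NormBounds.
Context {R : realType} (T : R) (pi : nat -> seq R).
Hypothesis T0 : 0 < T.
Implicit Types (x : R -> R) (al p : R).

Lemma Holder_norm_le x al S H :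
  (forall t, `|x t| <= S) ->
  (forall s t, 0 <= s <= T -> 0 <= t <= T -> `|x s - x t| <= H * `|s - t| `^ al) ->
  (Holder_norm T al x <= (S + H)%:E)%E.
Proof.
move=> hS hH; rewrite EFinD; apply: leeD; apply: ge_ereal_sup.
  by move=> _ [t _ <-]; rewrite lee_fin.
move=> _ [[s t] /= [sT tT st] <-]; rewrite lee_fin ler_pdivrMr.
  by apply: hH; [move: sT|move: tT]; rewrite in_itv.
by rewrite powR_gt0// normr_gt0 subr_eq0.
Qed.

Lemma pvar_norm_le x p V : x 0 = 0 ->
  (forall n, pvar pi p n x `^ p^-1 <= V) -> (pvar_norm pi p x <= V%:E)%E.
Proof.
move=> x0 hV; rewrite /pvar_norm x0 normr0 add0e.
by apply: ge_ereal_sup => _ [n _ <-]; rewrite lee_fin.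
Qed.

Lemma pvar_norm_bound x p V n : (pvar_norm pi p x <= V%:E)%E ->
  pvar pi p n x `^ p^-1 <= V.
Proof.
move=> h; rewrite -lee_fin; apply: le_trans h.
apply: (@le_trans _ _ (ereal_sup (range (fun n => (pvar pi p n x `^ p^-1)%:E)))).
  by apply: ereal_sup_ubound; exists n.
by rewrite leeDr// lee_fin.
Qed.

Lemma pvar_norm_ge0 x p : (0 <= pvar_norm pi p x)%E.
Proof.
apply: adde_ge0; first by rewrite lee_fin.
apply: (@le_trans _ _ (pvar pi p 0 x `^ p^-1)%:E); first by rewrite lee_fin powR_ge0.
by apply: ereal_sup_ubound; exists 0%N.
Qed.

(** Only the Hoelder seminorm and the variation are kept from the norm of x:
    their sum is at most 1, so the two bounds on the coefficients combine into
    a maximum. *)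
Lemma unit_ball_bounds x al p : (Holder_norm T al x + pvar_norm pi p x <= 1)%E ->
  exists h v : R, [/\ h + v <= 1, 0 <= h, 0 <= v,
    (forall s t, 0 <= s <= T -> 0 <= t <= T -> `|x s - x t| <= h * `|s - t| `^ al) &
    (forall n, pvar pi p n x `^ p^-1 <= v)].
Proof.
rewrite /Holder_norm; set SS := ereal_sup _; set SH := ereal_sup _ => h1.
have V0 := pvar_norm_ge0 x p; set V := pvar_norm pi p x in h1 V0.
have I0 : 0 \in `[0, T] by rewrite in_itv/= lexx ltW.
have IT : T \in `[0, T] by rewrite in_itv/= lexx ltW.
have SS0 : (0 <= SS)%E.
  apply: (@le_trans _ _ `|x 0|%:E); first by rewrite lee_fin.
  by apply: ereal_sup_ubound; exists 0.
have SH0 : (0 <= SH)%E.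
  apply: (@le_trans _ _ (`|x 0 - x T| / `|0 - T| `^ al)%:E).
    by rewrite lee_fin divr_ge0// powR_ge0.
  by apply: ereal_sup_ubound; exists (0, T) => //=; split=> //; rewrite lt_eqF.
have h2 : (SH + V <= 1)%E.
  by apply: le_trans h1; rewrite leeD2r// leeDr.
have SHf : SH \is a fin_num.
  rewrite ge0_fin_numE// (@le_lt_trans _ _ 1%E) ?ltry//.
  by apply: le_trans h2; rewrite leeDl.
have Vf : V \is a fin_num.
  rewrite ge0_fin_numE// (@le_lt_trans _ _ 1%E) ?ltry//.
  by apply: le_trans h2; rewrite leeDr.
exists (fine SH), (fine V); split.
- by rewrite -lee_fin EFinD !fineK.
- exact: fine_ge0.
- exact: fine_ge0.
- move=> s t sT tT; have [->|st] := eqVneq s t.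
    by rewrite subrr normr0 mulr_ge0 ?powR_ge0 ?fine_ge0.
  rewrite -ler_pdivrMr ?powR_gt0 ?normr_gt0 ?subr_eq0//.
  rewrite -lee_fin fineK//; apply: ereal_sup_ubound.
  by exists (s, t) => //=; rewrite !in_itv.
- by move=> n; apply: pvar_norm_bound; rewrite fineK.
Qed.

Lemma mx_sup_norm_bound (A : nat -> nat -> R) al s m l :
  (mx_sup_norm pi al A <= s%:E)%E -> mesh pi m.+1 `^ (1 / 2 - al) * `|A m l| <= s.
Proof.
by move=> h; rewrite -lee_fin; apply: le_trans h; apply: ereal_sup_ubound; exists (m, l).
Qed.

Lemma mx_sup_norm_ge0 (A : nat -> nat -> R) al : (0 <= mx_sup_norm pi al A)%E.
Proof.
apply: (@le_trans _ _ (mesh pi 1 `^ (1 / 2 - al) * `|A 0%N 0%N|)%:E).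
  by rewrite lee_fin mulr_ge0 ?powR_ge0.
by apply: ereal_sup_ubound; exists (0%N, 0%N).
Qed.

Lemma mx_p_norm_bound (A : nat -> nat -> R) p q m : 0 < p -> Mpi pi A ->
  (mx_p_norm pi p A <= q%:E)%E ->
  mesh pi m `^ (1 / 2) * (\sum_(l < cardI pi m) `|A m l| `^ p) `^ p^-1 <= q.
Proof.
move=> p0 MA; rewrite mx_p_normE// => h; rewrite -lee_fin; apply: le_trans h.
by apply: ereal_sup_ubound; exists m.
Qed.

Lemma mx_p_norm_ge0 (A : nat -> nat -> R) p : 0 < p -> Mpi pi A ->
  (0 <= mx_p_norm pi p A)%E.
Proof.
move=> p0 MA; rewrite mx_p_normE//; set F := fun m : nat => _%:E.
apply: (@le_trans _ _ (F 0%N)); first by rewrite lee_fin mulr_ge0 ?powR_ge0.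
by apply: ereal_sup_ubound; exists 0%N.
Qed.

Lemma lt_pinfty_bound (y : \bar R) : (0 <= y)%E -> (y < +oo)%E ->
  exists2 r : R, 0 < r & (y <= r%:E)%E.
Proof.
move=> y0 yoo; have yf : y \is a fin_num by rewrite ge0_fin_numE.
exists (fine y + 1); first by rewrite ltr_wpDl// fine_ge0.
by rewrite -(fineK yf) lee_fin lerDl.
Qed.

End NormBounds.

Section Isomorphism.
Context {R : realType} (T : R) (pi : nat -> seq R) (M : nat) (c a b : R)
  (e : nat -> seq (nat * nat)) (al p : R).
Hypothesis T0 : 0 < T.
Hypothesis al01 : 0 < al < 1.
Hypothesis p1 : 1 < p.
Hypothesis hpi : refining_partitions T pi.
Hypothesis hbal : balanced pi c.
Hypothesis href : complete_refining pi M a b.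
Hypothesis he : schauder_order pi e.

Let D := Holder T al `&` Xp T pi p `&` vanish_at_ends T.
Let ND := fun x : R -> R => (Holder_norm T al x + pvar_norm pi p x)%E.
Let E := Malpha pi al `&` Mp pi p.
Let NE := fun A : nat -> nat -> R => (mx_sup_norm pi al A + mx_p_norm pi p A)%E.
Let K1 := 1 / (1 - (1 + a) `^ (al - 1)).
Let K2 := 1 / (1 - (1 + a) `^ (- al)).
Let C1 := 2 * Num.sqrt c ^+ 3.
Let C2 := (M%:R + 1) ^+ 2 * c `^ (3 / 2) * b `^ (3 / 2 - 1 / p) /
            ((1 + a) `^ (1 - 1 / p) - 1) `^ (1 / p).
Let Z := c `^ (1 / p) * (M%:R * c * Num.sqrt (b * M%:R)) /
               ((1 + a) `^ (1 - 1 / p) - 1).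

Let p0 : 0 < p. Proof. exact: lt_trans p1. Qed.

Lemma Theta_sup_norm_le (x : R -> R) h :
  (forall s t, 0 <= s <= T -> 0 <= t <= T -> `|x s - x t| <= h * `|s - t| `^ al) ->
  (mx_sup_norm pi al (Theta pi e x) <= (C1 * h)%:E)%E.
Proof.
move=> H; apply: ge_ereal_sup => _ [[m l] _ <-] /=; rewrite lee_fin.
exact: (Theta_sup_le T0 hpi hbal he).
Qed.

Lemma Theta_p_norm_le (x : R -> R) v :
  (forall n, pvar pi p n x `^ p^-1 <= v) ->
  (mx_p_norm pi p (Theta pi e x) <= (C2 * v)%:E)%E.
Proof.
move=> H; rewrite mx_p_normE//; last exact: Theta_Mpi.
apply: ge_ereal_sup => _ [m _ <-] /=; rewrite lee_fin.
exact: (Theta_p_le T0 hpi hbal href he).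
Qed.

Lemma Theta_fun (x : R -> R) : D x -> E (Theta pi e x).
Proof.
move=> [[[_ [C HC]] [_ Vx]] _]; split; split; try exact: Theta_Mpi.
  apply: (@le_lt_trans _ _ (C1 * C)%:E); last exact: ltry.
  by apply: Theta_sup_norm_le => s t sT tT; apply: HC; rewrite in_itv.
have [v _ hv] := lt_pinfty_bound (pvar_norm_ge0 pi x p) Vx.
apply: (@le_lt_trans _ _ (C2 * v)%:E); last exact: ltry.
by apply: Theta_p_norm_le => n; exact: pvar_norm_bound hv.
Qed.

Lemma theta_Theta (x : R -> R) m k i : (k < size (pi m))%N ->
  (2 <= i < (nsub pi m k).+1)%N ->
  theta pi x m k i = Theta pi e x m (index (k, i) (e m)).
Proof.
move=> kN iN; have ki : (k, i) \in e m.
  by rewrite (perm_mem (he m)) mem_theta_indices kN.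
by rewrite ThetaE ?nth_index// -(size_order T0 hpi he) index_mem.
Qed.

Lemma Theta_inj : set_inj D (Theta pi e).
Proof.
move=> x y; rewrite !inE => -[[[[xc x0] _] _] [xl xr]] [[[[yc y0] _] _] [yl yr]] xy.
(* In this form, Theta z is given by the linearity of Theta. *)
pose z : R -> R := (-1) *: y + x.
have zE t : z t = x t - y t by rewrite /z fctE/= scaleN1r addrC.
have Tz : Theta pi e z = 0.
  by rewrite /z Theta_comb xy scaleN1r addNr.
have z0 t : z t = 0.
  apply: (theta_eq0 T0 hpi) => [||m k i kN iN].
  - split; last by move=> u uT; rewrite zE x0// y0// subrr.
    move/subspace_continuousP in xc; move/subspace_continuousP in yc.
    apply/subspace_continuousP => u uT; have -> : z = (fun t => x t - y t) by exact/funext.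
    exact: cvgB (xc u uT) (yc u uT).
  - by split; rewrite zE ?xl ?yl ?xr ?yr subrr.
  - by rewrite theta_Theta// Tz.
by apply/funext => t; apply/eqP; rewrite -subr_eq0 -zE z0.
Qed.

(** The preimage is the Schauder series of A. *)
Lemma Theta_surj_bounded (A : nat -> nat -> R) s q : 0 < s -> 0 < q ->
  Mpi pi A -> (mx_sup_norm pi al A <= s%:E)%E -> (mx_p_norm pi p A <= q%:E)%E ->
  exists x, [/\ D x, Theta pi e x = A &
   (ND x <= (M%:R / 2 * s * K2 * mesh pi 1 `^ al +
      s * (M%:R * Num.sqrt c * K1 + M%:R * K2) + Z * q)%:E)%E].
Proof.
move=> s0 q0 MA hs hq.
have hs' m l := mx_sup_norm_bound m l hs.
have hq' m := mx_p_norm_bound m p0 MA hq.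
have hH := schauder_series_Holder e T0 hpi hbal href al01 s0 hs'.
have hV n := pvar_schauder_series T0 hpi hbal href he n p1 q0 hq'.
have hC := schauder_series_C0 e T0 hpi hbal href al01 s0 hs'.
have hE := schauder_series_ends e T0 hpi A.
have hVn : (pvar_norm pi p (schauder_series pi e A) <= (Z * q)%:E)%E.
  by apply: pvar_norm_le; [case: hE|exact: hV].
exists (schauder_series pi e A); split.
- split=> //; split; split=> //.
    by eexists => u v; rewrite !in_itv/=; exact: hH.
  exact: le_lt_trans hVn (ltry _).
- exact: (Theta_schauder_series T0 hpi he MA).
- rewrite EFinD; apply: leeD => //; apply: Holder_norm_le => //.
  exact: (schauder_series_sup e T0 hpi href al01 s0 hs').
Qed.

Lemma Theta_surj : set_surj D E (Theta pi e).
Proof.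
move=> A [[MA sA] [_ pA]].
have [s s0 hs] := lt_pinfty_bound (mx_sup_norm_ge0 pi A al) sA.
have [q q0 hq] := lt_pinfty_bound (mx_p_norm_ge0 p0 MA) pA.
by have [x [Dx <- _]] := Theta_surj_bounded s0 q0 MA hs hq; exists x.
Qed.

Lemma Theta_op_norm_le : (op_norm D ND NE (Theta pi e) <= (Num.max C1 C2)%:E)%E.
Proof.
apply: ge_ereal_sup => _ [x [Dx /= Nx] <-].
have [h [v [hv h0 v0 H V]]] := unit_ball_bounds T0 Nx.
apply: (le_trans (leeD (Theta_sup_norm_le H) (Theta_p_norm_le V))).
rewrite -EFinD lee_fin; set m := Num.max _ _.
have m1 : C1 <= m by rewrite le_max lexx.
have m2 : C2 <= m by rewrite le_max lexx orbT.
have m0 : 0 <= m by apply: le_trans m1; rewrite mulr_ge0 ?exprn_ge0 ?sqrtr_ge0.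
apply: (@le_trans _ _ (m * (h + v))); last by rewrite ler_piMr.
by rewrite mulrDr; apply: lerD; apply: ler_wpM2r.
Qed.

(** The bounds on the sup-norm and on the Hoelder seminorm are half of the
    second and of the first entry of the maximum, so their sum is at most the
    maximum. *)
Lemma Theta_inverse_op_norm_le :
  (op_norm E NE ND (inverse_on D (Theta pi e)) <=
    (1 + Num.max (2 * M%:R * Num.sqrt c * K1 + 2 * M%:R * K2)
                 (M%:R * K2 * mesh pi 1 `^ al) + Z)%:E)%E.
Proof.
apply: ge_ereal_sup => _ [A [[[MA _] _] /= NA] <-].
have s0 := mx_sup_norm_ge0 pi A al; have q0 := mx_p_norm_ge0 p0 MA.
have hs : (mx_sup_norm pi al A <= 1%:E)%E by apply: le_trans NA; rewrite leeDl.
have hq : (mx_p_norm pi p A <= 1%:E)%E by apply: le_trans NA; rewrite leeDr.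
have [x [Dx <- Nx]] := Theta_surj_bounded ltr01 ltr01 MA hs hq.
have -> : inverse_on D (Theta pi e) (Theta pi e x) = x.
  by apply: pinvKV; [exact: Theta_inj|rewrite inE].
apply: (le_trans Nx).
rewrite lee_fin !mulr1 !mul1r lerD2r; set X := 2 * _ * _ * _ + _; set Y := M%:R * K2 * _.
have -> : M%:R / 2 * K2 * mesh pi 1 `^ al = Y / 2 by rewrite /Y; field.
have -> : M%:R * Num.sqrt c * K1 + M%:R * K2 = X / 2 by rewrite /X; field.
have mX : X <= Num.max X Y by rewrite le_max lexx.
have mY : Y <= Num.max X Y by rewrite le_max lexx orbT.
by lra.
Qed.

End Isomorphism.

Theorem theorem5p3 (R : realType) (T alpha p : R)
    (pi : nat -> seq R) (M : nat) (c a b : R)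
    (e : nat -> seq (nat * nat))
    (hT : 0 < T) (halpha : 0 < alpha < 1) (hp : 1 < p <= 1 / alpha)
    (hpi : refining_partitions T pi)
    (hbal : balanced pi c)
    (hconv : convergent_refining pi M a b)
    (he : schauder_order pi e) :
  let D := Holder T alpha `&` Xp T pi p `&` vanish_at_ends T in
  let ND := fun x : R -> R => (Holder_norm T alpha x + pvar_norm pi p x)%E in
  let E := Malpha pi alpha `&` Mp pi p in
  let NE := fun A : nat -> nat -> R =>
    (mx_sup_norm pi alpha A + mx_p_norm pi p A)%E in
  let K1 := 1 / (1 - (1 + a) `^ (alpha - 1)) in
  let K2 := 1 / (1 - (1 + a) `^ (- alpha)) in
  [/\ isomorphism D ND E NE (Theta pi e),
      (op_norm D ND NE (Theta pi e) <=
        (Num.max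
          (2 * Num.sqrt c ^+ 3)
          ((M%:R + 1) ^+ 2 * c `^ (3 / 2) * b `^ (3 / 2 - 1 / p) /
            ((1 + a) `^ (1 - 1 / p) - 1) `^ (1 / p)))%:E)%E &
      (op_norm E NE ND (inverse_on D (Theta pi e)) <=
        (1 + Num.max
               (2 * M%:R * Num.sqrt c * K1 + 2 * M%:R * K2)
               (M%:R * K2 * mesh pi 1 `^ alpha)
           + c `^ (1 / p) * (M%:R * c * Num.sqrt (b * M%:R)) /
               ((1 + a) `^ (1 - 1 / p) - 1))%:E)%E].
Proof.
move=> D ND E NE K1 K2.
have /andP[p1 _] := hp; have [href _] := hconv.
have bound := Theta_op_norm_le hT halpha p1 hpi hbal href he.
have inverse_bound := Theta_inverse_op_norm_le hT halpha p1 hpi hbal href he.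
split=> //; split.
- by move=> k x y _ _; exact: Theta_comb.
- split.
  + by move=> x; exact: (Theta_fun hT halpha p1 hpi hbal href he).
  + exact: (Theta_inj hT hpi he).
  + exact: (Theta_surj hT halpha p1 hpi hbal href he).
- exact: le_lt_trans bound (ltry _).
- exact: le_lt_trans inverse_bound (ltry _).
Qed.
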